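(* Let $S$ be a finite nonempty set of positive integers with $\max(S)=i$. Then the sequence $(\beta_S(\Pi_n))_{n\ge i+2}$ of $S_n$-characters stabilizes beyond $n=4i$. Moreover, when $S=\{i\}$, it stabilizes sharply at $n=4i$.
   Context: $\Pi_n$ is the lattice of set partitions of $\{1,\dots,n\}$ ordered by refinement ($\pi\le\sigma$ if every block of $\sigma$ is a union of blocks of $\pi$), graded with $\mathrm{rank}(\pi)=n-(\text{number of blocks of }\pi)$, so ranks run from $0$ to $n-1$; $S_n$ acts on it. For $T\subseteq\{1,\dots,n-2\}$, let $\Pi_n^T=\{\pi:\mathrm{rank}(\pi)\in T\}$ and let $\alpha_T(\Pi_n)$ be the character of the permutation representation of $S_n$ on the set of maximal chains of $\Pi_n^T$ (for $T=\emptyset$ this is the trivial character). Define $\beta_S(\Pi_n)=\sum_{T\subseteq S}(-1)^{|S\setminus T|}\alpha_T(\Pi_n)$ (which equals the character of the top reduced homology of the order complex of $\Pi_n^S$). Stabilization: for a partition $\lambda$ and $m\ge0$, $\lambda+(m)=(\lambda_1+m,\lambda_2,\dots)$; for $\chi=\sum c_\lambda\chi^\lambda$ set $\chi^{(+m)}=\sum c_\lambda\chi^{\lambda+(m)}$. A sequence $(\chi_n)$ stabilizes beyond $n_0$ if $\chi_n=\chi_{n_0}^{(+(n-n_0))}$ for all $n\ge n_0$, and sharply at $n_0$ if $n_0$ is minimal with this property. *)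

(* Defs.v *)
From HB Require Import structures.
From mathcomp Require Import all_boot all_order all_algebra all_fingroup.
From mathcomp Require Import ssrint rat.
Set Implicit Arguments.
Unset Strict Implicit.
Unset Printing Implicit Defensive.
Import GRing.Theory Num.Theory.

Definition cyc_lens n (g : {perm 'I_n}) : seq nat :=
  map (fun c : {set 'I_n} => #|c|) (enum (porbits g)).

(* coefficient of x^a in the power sum p_mu in l variables:
   number of maps f from the parts of mu to the variables with
   sum_{f k = j} mu_k = a_j for every j *)
Definition pcoef (mu : seq nat) (l : nat) (a : 'I_l -> int) : nat :=
  #|[set f : {ffun 'I_(size mu) -> 'I_l} |
     [forall j : 'I_l, (Posz (\sum_(k < size mu | f k == j) nth 0%N mu k)%N == a j)]]|.

(* chi^la(g) = [x^(la+delta)] (a_delta * p_{cycle type of g}), ell = size la variables *)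
Definition irr_char (la : seq nat) n (g : {perm 'I_n}) : int :=
  \sum_(s : 'S_(size la))
     ((-1) ^+ odd_perm s * Posz (pcoef (cyc_lens g)
        (fun j => Posz (nth 0%N la j) - Posz (val j) + Posz (val (s j)))))%R.

Definition is_part n (t : {ffun 'I_n -> 'I_n.+1}) : bool :=
  [forall i : 'I_n, forall j : 'I_n, (i <= j)%N ==> (val (t j) <= val (t i))%N]
  && ((\sum_(i < n) val (t i))%N == n).

Definition partitions n : seq (seq nat) :=
  map (fun t : {ffun 'I_n -> 'I_n.+1} =>
         filter (fun x => 0 < x)%N (map (fun i => val (t i)) (enum 'I_n)))
      (filter (@is_part n) (enum {ffun 'I_n -> 'I_n.+1})).

Definition add_first (la : seq nat) (m : nat) : seq nat :=
  if la is x :: r then (x + m)%N :: r else [:: m].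

Definition mult n0 (chi : {perm 'I_n0} -> int) (la : seq nat) : rat :=
  ((\sum_(g : {perm 'I_n0}) chi g * irr_char la g)%R%:~R / (n0`!)%:R)%R.

Definition stab_plus n0 (chi : {perm 'I_n0} -> int) (m : nat)
    (g : {perm 'I_(n0 + m)}) : rat :=
  (\sum_(la <- partitions n0) mult chi la * (irr_char (add_first la m) g)%:~R)%R.

Definition stab_beyond (chi : forall n, {perm 'I_n} -> int) (n0 : nat) : Prop :=
  forall m (g : {perm 'I_(n0 + m)}),
    ((chi (n0 + m)%N g)%:~R : rat) = @stab_plus n0 (chi n0) m g.

Definition setpart n : {set {set {set 'I_n}}} :=
  [set P : {set {set 'I_n}} | partition P [set: 'I_n]].

Definition refines n (P Q : {set {set 'I_n}}) : bool :=
  [forall C in Q, exists X : {set {set 'I_n}}, (X \subset P) && (C == cover X)].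

Definition prank n (P : {set {set 'I_n}}) : nat := (n - #|P|)%N.

Definition rank_sel n (T : {set 'I_n}) : {set {set {set 'I_n}}} :=
  [set P in setpart n | [exists t in T, val t == prank P]].

Definition is_chain n (C : {set {set {set 'I_n}}}) : bool :=
  [forall P in C, forall Q in C, refines P Q || refines Q P].

Definition max_chain n (T : {set 'I_n}) (C : {set {set {set 'I_n}}}) : bool :=
  [&& C \subset rank_sel T, is_chain C &
      [forall D : {set {set {set 'I_n}}},
         [&& is_chain D, D \subset rank_sel T & C \subset D] ==> (D == C)]].

Definition pact n (g : {perm 'I_n}) (P : {set {set 'I_n}}) : {set {set 'I_n}} :=
  [set [set g x | x in B] | B : {set 'I_n} in P].

Definition chain_act n (g : {perm 'I_n}) (C : {set {set {set 'I_n}}}) :=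
  [set pact g P | P : {set {set 'I_n}} in C].

Definition alpha n (T : {set 'I_n}) (g : {perm 'I_n}) : nat :=
  #|[set C | max_chain T C & chain_act g C == C]|.

Definition Sset n (S : seq nat) : {set 'I_n} := [set t : 'I_n | val t \in S].

Definition beta (S : seq nat) n (g : {perm 'I_n}) : int :=
  (\sum_(T : {set 'I_n} | T \subset Sset n S)
     (-1) ^+ #|Sset n S :\: T| * Posz (alpha T g))%R.

(* Main.v *)
(* A chain whose ranks are at most i only involves a set A of at most 2i points,
   the union of the non-singleton blocks of its largest element. Hence the chain
   characters are sums, over k <= 2i, of characters of S_n induced from
   F_k x 1 on S_k x S_(n-k), where F_k does not depend on n. Expanding F_k in
   irreducibles and applying the Pieri rule, the multiplicity of chi^la in
   beta_S is the sum over mu of the coefficient of chi^mu in F_k times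
   [la/mu is a horizontal strip]. For n >= 2k, adding m boxes to the first row
   of la does not change this condition, and every la of size n + m that
   satisfies it has la_1 - la_2 >= m; this gives stability beyond n = 4i.
   For S = {i} and n = 4i only k = 2i and mu = (2i) contribute to chi^(2i,2i), with
   multiplicity the (positive) number of orbits on perfect matchings of 2i points.
   As (2i,2i) is not of the form la + (m) with m > 0, stability cannot start earlier.
   The expansion in irreducibles rests on the orthonormality of the
   Jacobi-Trudi characters, proved by comparing first rows, together with the fact
   that their number equals the number of cycle types. *)
Require Import Defs.
From HB Require Import structures.
From mathcomp Require Import all_boot all_order all_algebra all_fingroup.
From mathcomp Require Import ssrint rat zify ring lra.
Set Implicit Arguments.
Unset Strict Implicit.
Unset Printing Implicit Defensive.
Import Order.TTheory GRing.Theory Num.Theory.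

(** * Alternants *)

(** Characters are handled as counting functions: [irr_char] is an alternating sum of numbers of
    colourings constant on cycles, and summing a product of two such numbers over S_n counts
    contingency tables up to the factor n!. All inner products thus become alternants of table
    counts, and one sign-reversing argument, [alternate_strip], serves twice: iterated it gives
    orthonormality, and combined with orthonormality it gives the Pieri multiplicities. The bound 2i
    on the support comes from spreading the rank over the points: a point of a block B contributes 1
    - 1/|B|, which is at least 1/2 unless B is a singleton. The other factor 2 in 4i makes n - k >=
    k: a shape of size n that differs from mu by a horizontal strip has first row at least n - k,
    while mu has first row at most k. Since the coefficients must not depend on n, different ground
    sets have to be compared: shapes are functions on [nat], rank sets are lists of [nat], and
    chains are transported along bijections between subsets of ['I_n] and ['I_n']. *)

Section Alternants.
Local Open Scope ring_scope.

(* For f a = (value at g of the permutation character of the Young subgroup of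
   type a) and x = (la_j - j)_j this is the Jacobi-Trudi formula for chi^la(g). *)
Definition alternate l (f : {ffun 'I_l -> int} -> int) (x : {ffun 'I_l -> int}) : int :=
  \sum_(s : 'S_l) (-1) ^+ odd_perm s * f [ffun j => x j + Posz (s j)].

Definition sym_fun l (f : {ffun 'I_l -> int} -> int) :=
  forall (t : 'S_l) (a : {ffun 'I_l -> int}), f [ffun j => a (t j)] = f a.

Definition nonneg_supp l (f : {ffun 'I_l -> int} -> int) :=
  forall (a : {ffun 'I_l -> int}) (j : 'I_l), a j < 0 -> f a = 0.

Definition jt_shift l (la : nat -> nat) : {ffun 'I_l -> int} :=
  [ffun j : 'I_l => Posz (la j) - Posz j].

Lemma eq_alternate l f g (x : {ffun 'I_l -> int}) :
  f =1 g -> alternate f x = alternate g x.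
Proof. by move=> fg; apply: eq_bigr => s _; rewrite fg. Qed.

Lemma alternate_sum l (I : finType) (P : pred I) F (x : {ffun 'I_l -> int}) :
  alternate (fun a => \sum_(i | P i) F i a) x = \sum_(i | P i) alternate (F i) x.
Proof.
rewrite exchange_big /=; apply: eq_bigr => s _; by rewrite mulr_sumr.
Qed.

(** Multiplying the summation permutation by [t] changes its sign by that of [t], and the symmetry
    of [f] absorbs the resulting permutation of the coordinates. *)
Lemma alternate_perm l f (t : 'S_l) (x : {ffun 'I_l -> int}) : sym_fun f ->
  alternate f [ffun j => x (t j)] = (-1) ^+ odd_perm t * alternate f x.
Proof.
move=> fsym; rewrite /alternate (reindex_inj (mulgI t)) mulr_sumr.
apply: eq_bigr => s _; rewrite odd_permM signr_addb -mulrA; congr (_ * (_ * _)).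
rewrite -(fsym t [ffun j => x j + Posz (s j)]); congr f.
by apply/ffunP => j; rewrite !ffunE permM.
Qed.

(** The swap reverses the sign of each alternant and maps the index set to itself, so the sum equals
    its own negative. The constant [c] lets natural entries encode integers that may be negative. *)
Lemma sum_alternate_swap l B f (P : pred {ffun 'I_l -> 'I_B}) (c : nat) (i j : 'I_l) :
    sym_fun f -> i != j ->
    (forall w : {ffun 'I_l -> 'I_B}, P [ffun k => w (tperm i j k)] = P w) ->
  \sum_(w : {ffun 'I_l -> 'I_B} | P w)
     alternate f [ffun k => Posz (w k) - Posz c] = 0.
Proof.
move=> fsym neq_ij Psw; set X := \sum_(w | P w) _.
suff: X = - X by lia.
pose h (w : {ffun 'I_l -> 'I_B}) := [ffun k => w (tperm i j k)].
have hK : cancel h h by move=> w; apply/ffunP => k; rewrite !ffunE tpermK.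
rewrite {1}/X (reindex_inj (can_inj hK)) -sumrN; apply: eq_big => // w _.
have -> : [ffun k => Posz (h w k) - Posz c] =
  [ffun k => [ffun k => Posz (w k) - Posz c] (tperm i j k)].
  by apply/ffunP => k; rewrite !ffunE.
by rewrite alternate_perm // odd_tperm neq_ij expr1 mulN1r.
Qed.

(* Pieri rule. Put w_j = la_j - j - m_j. If j is the first index with
   w_j <= la_(j+1) - (j+1), then exchanging w_j and w_(j+1) preserves the index
   set and changes the sign of the alternant, so these terms cancel. Below, w is
   shifted by l in order to take natural values. *)
Lemma alternate_strip l B f (la : nat -> nat) b :
    sym_fun f -> nonneg_supp f ->
    (forall j, la j.+1 <= la j)%N -> la l = 0%N -> (la 0 + l < B)%N ->
  \sum_(m : {ffun 'I_l -> 'I_B} | (\sum_j m j)%N == b)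
     alternate f [ffun j => jt_shift l la j - Posz (m j)] =
  \sum_(v : {ffun 'I_l -> 'I_B} |
     [forall j : 'I_l, la j.+1 <= v j <= la j]%N &&
     ((\sum_j v j + b)%N == \sum_(j < l) la j)%N)
     alternate f [ffun j : 'I_l => Posz (v j) - Posz j].
Proof.
move=> fsym fneg la_dec la_l ltB.
have la_le j : (la j <= la 0)%N.
  by elim: j => // j IH; apply: leq_trans (la_dec j) IH.
pose rho (j : nat) := (la j + (l - j))%N.
have rhoB j : (rho j < B)%N by have := la_le j; rewrite /rho; lia.
have B_gt0 : (0 < B)%N by lia.
case: B B_gt0 ltB rhoB => // B _ ltB rhoB.
pose F (w : {ffun 'I_l -> 'I_B.+1}) := alternate f [ffun j => Posz (w j) - Posz l].
pose Q (w : {ffun 'I_l -> 'I_B.+1}) :=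
  [forall j : 'I_l, w j <= rho j]%N && ((\sum_j w j + b)%N == (\sum_(j < l) rho j)%N).
(* A permutation adds at most l - 1 to coordinate j, so every term of such an alternant has a
   negative coordinate. *)
have altneg (x : {ffun 'I_l -> int}) : (exists j : 'I_l, x j + Posz l <= 0) -> alternate f x = 0.
  move=> [j xj]; apply: big1 => s _; rewrite (fneg _ j) ?mulr0 // ffunE.
  by have := ltn_ord (s j); lia.
transitivity (\sum_(w | Q w) F w).
  rewrite (bigID (fun m : {ffun 'I_l -> 'I_B.+1} => [forall j : 'I_l, m j <= rho j]%N)) /=.
  rewrite [X in _ + X]big1 ?addr0; last first.
    move=> m /andP[_ /forallPn[j mj]]; apply: altneg; exists j; rewrite !ffunE.
    by move: mj; rewrite /rho; have := ltn_ord j; lia.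
  (* On the terms with m_j <= rho_j the substitution m = rho - w is its own inverse; the other terms
     were just discarded by [altneg]. *)
  pose h (w : {ffun 'I_l -> 'I_B.+1}) : {ffun 'I_l -> 'I_B.+1} :=
    [ffun j : 'I_l => inord (rho j - w j)%N].
  have hE w (j : 'I_l) : h w j = (rho j - w j)%N :> nat.
    by rewrite ffunE inordK // ltnS (leq_trans (leq_subr _ _)) // -ltnS.
  have hK (w : {ffun 'I_l -> 'I_B.+1}) : [forall j : 'I_l, w j <= rho j]%N -> h (h w) = w.
    move/forallP=> le_w; apply/ffunP => j; apply: val_inj => /=.
    by rewrite hE hE subKn.
  have hle w : [forall j : 'I_l, h w j <= rho j]%N.
    by apply/forallP => j; rewrite hE leq_subr.
  rewrite (reindex_onto h h) => [|m /andP[_ /hK] //].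
  apply: eq_big => [w|w].
    rewrite hle andbT /Q; apply/andP/andP => [[/eqP <- /eqP hw]|[le_w /eqP sw]].
      have le_w : [forall j : 'I_l, w j <= rho j]%N by rewrite -hw.
      split=> //; rewrite -big_split /=; apply/eqP/eq_bigr => j _.
      by rewrite hE subnKC //; apply: (forallP le_w).
    rewrite hK //; split=> //; apply/eqP; apply: (@addnI (\sum_j w j)%N).
    rewrite sw -big_split /=; apply: eq_bigr => j _.
    by rewrite hE subnKC //; apply: (forallP le_w).
  move=> /andP[_ /eqP hw]; have le_w : [forall j : 'I_l, w j <= rho j]%N by rewrite -hw.
  congr (alternate f _); apply/ffunP => j; rewrite !ffunE inordK; last first.
    by rewrite ltnS (leq_trans (leq_subr _ _)) // -ltnS.
  have := forallP le_w j; have : (nat_of_ord j < l)%N := ltn_ord j.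
  by rewrite /rho; move: (nat_of_ord (w j)) (nat_of_ord j) => p q; lia.
transitivity (\sum_(w | Q w && [forall j : 'I_l, rho j.+1 < w j]%N) F w).
  (* [R k] imposes the strip condition on the first k rows only; each step from k to k+1 removes a
     family of terms with sum 0. *)
  pose R k (w : {ffun 'I_l -> 'I_B.+1}) := [forall j : 'I_l, (j < k)%N ==> (rho j.+1 < w j)%N].
  have -> : \sum_(w | Q w) F w = \sum_(w | Q w && R 0%N w) F w.
    by apply: eq_bigl => w; rewrite (_ : R _ _) ?andbT //; apply/forallP.
  have -> : \sum_(w | Q w && [forall j : 'I_l, (rho j.+1 < w j)%N]) F w =
            \sum_(w | Q w && R l w) F w.
    by apply: eq_bigl => w; congr (_ && _); apply: eq_forallb => j; rewrite ltn_ord.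
  suff step k : (k < l)%N ->
      \sum_(w | Q w && R k w) F w = \sum_(w | Q w && R k.+1 w) F w.
    suff H k : (k <= l)%N -> \sum_(w | Q w && R 0%N w) F w = \sum_(w | Q w && R k w) F w.
      exact: H.
    by elim: k => // k IH ltk; rewrite (IH (ltnW ltk)) (step _ ltk).
  move=> ltk; pose kk := Ordinal ltk.
  have RS w : R k.+1 w = R k w && (rho k.+1 < w kk)%N.
    apply/forallP/andP => [H|[/forallP H Hk] j].
      split; last by have /implyP := H kk; apply.
      by apply/forallP => j; apply/implyP => jk; apply: (implyP (H j)); rewrite ltnS ltnW.
    apply/implyP; rewrite ltnS leq_eqVlt => /predU1P[jk|]; last exact: (implyP (H j)).
    by have -> : j = kk by apply: val_inj.
  rewrite (bigID (fun w : {ffun _ -> 'I_B.+1} => rho k.+1 < w kk)%N) /=.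
  rewrite [X in _ + X](_ : _ = 0) ?addr0.
    by apply: eq_bigl => w; rewrite RS andbA.
  (* In the last row rho_l = 0, so failure means w_k = 0 and each alternant vanishes by itself;
     there is no row below to swap with. *)
  have [ltk1|] := boolP (k.+1 < l)%N; last first.
    move=> nk1; have k1 : k.+1 = l by lia.
    apply: big1 => w /andP[_]; rewrite -leqNgt => wk; apply: altneg; exists kk.
    by move: wk; rewrite !ffunE /rho k1 la_l subnn; lia.
  apply: (@sum_alternate_swap _ _ _ _ _ kk (Ordinal ltk1)) => //.
    by rewrite -val_eqE /=; lia.
  (* Failure at k says w_k <= rho_(k+1), and [Q] gives w_(k+1) <= rho_(k+1); the swap exchanges
     these two conditions. *)
  suff imp w : Q w && R k w && ~~ (rho k.+1 < w kk)%N ->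
      Q [ffun j => w (tperm kk (Ordinal ltk1) j)] && R k [ffun j => w (tperm kk (Ordinal ltk1) j)]
      && ~~ (rho k.+1 < [ffun j => w (tperm kk (Ordinal ltk1) j)] kk)%N.
    move=> w; apply/idP/idP => [/imp|]; last exact: imp.
    congr (_ && _ && ~~ (_ < _)%N).
    - by congr Q; apply/ffunP => j; rewrite !ffunE tpermK.
    - by congr R; apply/ffunP => j; rewrite !ffunE tpermK.
    by rewrite !ffunE tpermK.
  case/andP=> /andP[/andP[/forallP le_w sw] /forallP Rw]; rewrite -leqNgt => wk.
  rewrite -leqNgt ffunE tpermL (le_w (Ordinal ltk1)) andbT; apply/andP; split; last first.
    apply/forallP => j; apply/implyP => jk; rewrite ffunE tpermD ?(implyP (Rw j)) //.
      by rewrite -val_eqE /=; lia.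
    by rewrite -val_eqE /=; lia.
  apply/andP; split.
    apply/forallP => j; rewrite ffunE; case: tpermP => [->|->|_ _]; last exact: le_w.
      by apply: leq_trans (le_w (Ordinal ltk1)) _; have := la_dec k; rewrite /rho /=; lia.
    by apply: wk.
  rewrite -(eqP sw); apply/eqP; congr (_ + _)%N.
  rewrite [RHS](reindex_inj (@perm_inj _ (tperm kk (Ordinal ltk1)))).
  by apply: eq_bigr => j _; rewrite ffunE.
(* Since rho_j - la_j = l - j drops by one from row to row, the strict bound rho_(j+1) < w_j becomes
   the weak bound la_(j+1) <= v_j. *)
pose h (v : {ffun 'I_l -> 'I_B.+1}) : {ffun 'I_l -> 'I_B.+1} :=
  [ffun j : 'I_l => inord (v j + (l - j))%N].
pose h' (w : {ffun 'I_l -> 'I_B.+1}) : {ffun 'I_l -> 'I_B.+1} :=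
  [ffun j : 'I_l => inord (w j - (l - j))%N].
have h'E w (j : 'I_l) : h' w j = (w j - (l - j))%N :> nat.
  by rewrite ffunE inordK // ltnS (leq_trans (leq_subr _ _)) // -ltnS.
have srho : (\sum_(j < l) rho j = \sum_(j < l) la j + \sum_(j < l) (l - j))%N.
  by rewrite -big_split.
rewrite (reindex_onto h h') => [|w /andP[/andP[/forallP le_w _] /forallP gt_w]]; last first.
  have wj (j : 'I_l) : (w j - (l - j) + (l - j))%N = w j.
    move: (gt_w j) (ltn_ord j); rewrite /rho.
    by move: (nat_of_ord (w j)) (nat_of_ord j) => p q; lia.
  by apply/ffunP => j; apply: val_inj; rewrite /= ffunE h'E wj inord_val.
apply: eq_big => [v|v /andP[_ /eqP hv]]; last first.
  congr (alternate f _); apply/ffunP => j; rewrite !ffunE.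
  have := congr1 (fun w : {ffun 'I_l -> 'I_B.+1} => nat_of_ord (w j)) hv; rewrite /= h'E !ffunE.
  move: (ltn_ord j) (ltn_ord (v j)).
  case: (ltnP (v j + (l - j)) B.+1) => vj.
    by rewrite inordK //; move: (nat_of_ord (v j)) (nat_of_ord j) => p q; lia.
  rewrite /inord /insubd insubN -?leqNgt //=.
  by move: (nat_of_ord (v j)) (nat_of_ord j) vj => p q; lia.
have hE' (j : 'I_l) : (v j <= la j)%N -> h v j = (v j + (l - j))%N :> nat.
  by move=> vj; rewrite ffunE inordK //; apply: leq_ltn_trans (rhoB j); rewrite /rho leq_add2r.
have sumE : [forall j : 'I_l, v j <= la j]%N ->
    (\sum_j h v j = \sum_j v j + \sum_(j < l) (l - j))%N.
  by move/forallP=> vle; rewrite -big_split; apply: eq_bigr => j _; apply: hE'.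
have hvle : [forall j : 'I_l, v j <= la j]%N -> h' (h v) = v.
  move/forallP=> vle; apply/ffunP => j; apply: val_inj => /=.
  by rewrite h'E hE' // addnK.
apply/andP/andP.
  move=> [/andP[/andP[/forallP le_w sw] /forallP gt_w] /eqP hv].
  have vle : [forall j : 'I_l, v j <= la j]%N.
    apply/forallP => j; have := congr1 (fun w : {ffun 'I_l -> 'I_B.+1} => nat_of_ord (w j)) hv.
    rewrite /= h'E; move: (le_w j) (ltn_ord j); rewrite /rho.
    by move: (nat_of_ord (h v j)) (nat_of_ord (v j)) (nat_of_ord j) => p q r; lia.
  split; last by move: sw; rewrite sumE // srho addnAC eqn_add2r.
  apply/forallP => j; rewrite (forallP vle) andbT.
  move: (gt_w j) (ltn_ord j); rewrite hE' ?(forallP vle) // /rho.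
  by move: (nat_of_ord (v j)) (nat_of_ord j) => p q; lia.
move=> [/forallP il sv].
have vle : [forall j : 'I_l, v j <= la j]%N by apply/forallP => j; case/andP: (il j).
split; last by rewrite hvle.
apply/andP; split.
  apply/andP; split; last by rewrite sumE // srho addnAC eqn_add2r.
  by apply/forallP => j; rewrite hE' ?(forallP vle) // /rho leq_add2r; apply: (forallP vle).
apply/forallP => j; rewrite hE' ?(forallP vle) // /rho.
move: (il j) (ltn_ord j).
by move: (nat_of_ord (v j)) (nat_of_ord j) => p q; lia.
Qed.

End Alternants.

(** * Counting by injections and bijections; permutations fixing a point *)

Lemma leq_card_in_inj (T T' : finType) (h : T -> T') (A : {pred T}) (A' : {pred T'}) :
  {in A &, injective h} -> {in A, forall x, h x \in A'} -> #|A| <= #|A'|.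
Proof.
move=> hinj hA; rewrite -(card_in_image hinj); apply: subset_leq_card.
by apply/subsetP => _ /imageP[x xA ->]; apply: hA.
Qed.

Lemma eq_card_bij (T T' : finType) (h : T -> T') (h' : T' -> T)
    (A : {pred T}) (A' : {pred T'}) :
    {in A, forall x, h x \in A'} -> {in A', forall y, h' y \in A} ->
    {in A, cancel h h'} -> {in A', cancel h' h} ->
  #|A| = #|A'|.
Proof.
move=> hA hA' hK hK'; apply/eqP; rewrite eqn_leq.
by rewrite (leq_card_in_inj (can_in_inj hK) hA) (leq_card_in_inj (can_in_inj hK') hA').
Qed.

(** The permutations that fix [ord0] form a copy of S_n. This is how the first row is deleted in
    [jt_pair_rec]. *)
Lemma big_lift_perm0 n (R : nmodType) (F : 'S_n.+1 -> R) :
  (\sum_(s : 'S_n.+1 | s ord0 == ord0) F s = \sum_(s : 'S_n) F (lift_perm ord0 ord0 s))%R.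
Proof.
rewrite (reindex (lift_perm ord0 ord0)) => [|/=]; last first.
  pose g (s : 'S_n.+1) k := odflt k (unlift ord0 (s (lift ord0 k))).
  have gK (s : 'S_n.+1) k : s ord0 = ord0 -> lift ord0 (g s k) = s (lift ord0 k).
    rewrite /g => s0; have: s (lift ord0 k) != ord0.
      by rewrite -[X in _ != X]s0 (inj_eq perm_inj).
    by rewrite eq_sym => /unlift_some[? ? ->].
  pose g' (s : 'S_n.+1) : 'S_n :=
    if insub (finfun (g s)) is Some p then p else 1%g.
  have g'E (s : 'S_n.+1) k : s ord0 = ord0 -> g' s k = g s k.
    move=> s0; rewrite /g' insubT => [|inj]; last first.
      by rewrite -pvalE /= ffunE.
    apply/injectiveP => i j; rewrite !ffunE => /(congr1 (lift ord0)).
    by rewrite !gK // => /perm_inj/lift_inj.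
  exists g' => s.
    move=> _; apply/permP => k; rewrite g'E ?lift_perm_id //.
    by rewrite /g lift_perm_lift liftK.
  move=> /eqP s0; apply/permP => k; case: (unliftP ord0 k) => [k'|] ->.
    by rewrite lift_perm_lift g'E // gK.
  by rewrite lift_perm_id s0.
by apply: eq_bigl => s; rewrite lift_perm_id eqxx.
Qed.

(** * Contingency tables and orthonormality of Jacobi-Trudi alternants *)

Section Tables.
Local Open Scope ring_scope.

(** Contingency tables with row sums [a] and column sums [b]; [B] bounds the entries to keep the
    type finite. For [B] larger than n, n! times this number is the sum over S_n of the product of
    the two Young permutation characters ([sum_pcoefM]). *)
Definition tables B l l' (a : {ffun 'I_l -> int}) (b : {ffun 'I_l' -> int}) : nat :=
  #|[set A : {ffun 'I_l * 'I_l' -> 'I_B} |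
     [forall j, Posz (\sum_s A (j, s))%N == a j] &&
     [forall s, Posz (\sum_j A (j, s))%N == b s]]|.

Lemma tables_tr B l l' (a : {ffun 'I_l -> int}) (b : {ffun 'I_l' -> int}) :
  tables B a b = tables B b a.
Proof.
pose h m m' (A : {ffun 'I_m * 'I_m' -> 'I_B}) : {ffun 'I_m' * 'I_m -> 'I_B} := [ffun p : 'I_m' * 'I_m => A (p.2, p.1)].
have hK m m' : cancel (@h m m') (@h m' m).
  by move=> A; apply/ffunP => -[i j]; rewrite !ffunE.
have hP m m' (c : {ffun 'I_m -> int}) (d : {ffun 'I_m' -> int})
      (A : {ffun 'I_m * 'I_m' -> 'I_B}) :
    [forall j, Posz (\sum_s A (j, s))%N == c j] && [forall s, Posz (\sum_j A (j, s))%N == d s] ->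
    [forall j, Posz (\sum_s h _ _ A (j, s))%N == d j] &&
    [forall s, Posz (\sum_j h _ _ A (j, s))%N == c s].
  move=> /andP[/forallP Hc /forallP Hd]; apply/andP; split; apply/forallP => j.
    by rewrite -(eqP (Hd j)); apply/eqP; congr Posz; apply: eq_bigr => s _; rewrite ffunE.
  by rewrite -(eqP (Hc j)); apply/eqP; congr Posz; apply: eq_bigr => s _; rewrite ffunE.
apply: (@eq_card_bij _ _ (@h _ _) (@h _ _)) => A.
- by rewrite !inE; apply: hP.
- by rewrite !inE; apply: hP.
- by move=> _; apply: hK.
- by move=> _; apply: hK.
Qed.

Lemma tables_sym B l l' (b : {ffun 'I_l' -> int}) :
  sym_fun (fun a : {ffun 'I_l -> int} => Posz (tables B a b)).
Proof.
move=> t a; congr Posz.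
pose h (t : 'S_l) (A : {ffun 'I_l * 'I_l' -> 'I_B}) : {ffun 'I_l * 'I_l' -> 'I_B} :=
  [ffun p : 'I_l * 'I_l' => A (t p.1, p.2)].
have hP t' (c : {ffun 'I_l -> int}) (A : {ffun 'I_l * 'I_l' -> 'I_B}) :
    [forall j, Posz (\sum_s A (j, s))%N == c j] && [forall s, Posz (\sum_j A (j, s))%N == b s] ->
    [forall j, Posz (\sum_s h t' A (j, s))%N == c (t' j)] &&
    [forall s, Posz (\sum_j h t' A (j, s))%N == b s].
  move=> /andP[/forallP Hc /forallP Hd]; apply/andP; split; apply/forallP => j.
    by rewrite -(eqP (Hc (t' j))); apply/eqP; congr Posz; apply: eq_bigr => s _; rewrite ffunE.
  rewrite -(eqP (Hd j)) [X in _ == Posz X](reindex_inj (@perm_inj _ t')).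
  by apply/eqP; congr Posz; apply: eq_bigr => s _; rewrite ffunE.
apply: (@eq_card_bij _ _ (h t^-1%g) (h t)) => A; rewrite ?inE.
- move=> /(hP t^-1%g) /andP[/forallP H ->]; rewrite andbT; apply/forallP => j.
  by rewrite (eqP (H j)) !ffunE permKV.
- move=> /(hP t) /andP[/forallP H ->]; rewrite andbT; apply/forallP => j.
  by rewrite (eqP (H j)) !ffunE.
- by move=> _; apply/ffunP => -[i j]; rewrite !ffunE /= permK.
- by move=> _; apply/ffunP => -[i j]; rewrite !ffunE /= permKV.
Qed.

Lemma tables_nonneg B l l' (b : {ffun 'I_l' -> int}) :
  nonneg_supp (fun a : {ffun 'I_l -> int} => Posz (tables B a b)).
Proof.
move=> a j aj; apply/eqP; rewrite eqz_nat cards_eq0; apply/eqP/setP => A; rewrite !inE.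
by apply/negP => /andP[/forallP/(_ j)/eqP aE _]; move: aj; rewrite -aE.
Qed.

(** Fixing the first column [m] leaves a table whose row sums are lowered by [m], which is the form
    of argument treated by [alternate_strip]. *)
Lemma tables_peel B l l' (a : {ffun 'I_l -> int}) (b : {ffun 'I_l'.+1 -> int}) :
  Posz (tables B a b) =
  \sum_(m : {ffun 'I_l -> 'I_B} | Posz (\sum_j m j)%N == b ord0)
    Posz (tables B [ffun j => a j - Posz (m j)] [ffun s => b (lift ord0 s)]).
Proof.
rewrite -[LHS]natz /tables -sum1_card natr_sum.
pose c (A : {ffun 'I_l * 'I_l'.+1 -> 'I_B}) := [ffun j => A (j, ord0)].
rewrite (partition_big c (fun m : {ffun 'I_l -> 'I_B} => Posz (\sum_j m j)%N == b ord0)).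
  apply: eq_bigr => m /eqP m0; rewrite -natr_sum natz sum1dep_card; congr Posz.
  pose h (A : {ffun 'I_l * 'I_l'.+1 -> 'I_B}) : {ffun 'I_l * 'I_l' -> 'I_B} :=
    [ffun p : 'I_l * 'I_l' => A (p.1, lift ord0 p.2)].
  pose h' (A : {ffun 'I_l * 'I_l' -> 'I_B}) : {ffun 'I_l * 'I_l'.+1 -> 'I_B} :=
    [ffun p : 'I_l * 'I_l'.+1 => if unlift ord0 p.2 is Some s then A (p.1, s) else m p.1].
  apply: (@eq_card_bij _ _ h h') => A; rewrite ?inE.
  - move=> /andP[/andP[/forallP Ha /forallP Hb] /eqP cA]; apply/andP; split.
      apply/forallP => j; rewrite ffunE -(eqP (Ha j)) big_ord_recl PoszD -cA ffunE addrC addKr.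
      by apply/eqP; congr Posz; apply: eq_bigr => s _; rewrite ffunE.
    apply/forallP => s; rewrite ffunE -(eqP (Hb (lift ord0 s))).
    by apply/eqP; congr Posz; apply: eq_bigr => j _; rewrite ffunE.
  - move=> /andP[/forallP Ha /forallP Hb]; rewrite -andbA; apply/and3P; split.
    + apply/forallP => j; rewrite big_ord_recl PoszD ffunE unlift_none /=.
      have := eqP (Ha j); rewrite ffunE => /(canLR (subrK _)) <-; rewrite addrC.
      by apply/eqP; congr (Posz _ + _); apply: eq_bigr => s _; rewrite ffunE /= liftK.
    + apply/forallP => s; case: (unliftP ord0 s) => [s'|] ->.
        have := eqP (Hb s'); rewrite ffunE => <-.
        by apply/eqP; congr Posz; apply: eq_bigr => j _; rewrite ffunE /= liftK.
      by rewrite -m0; apply/eqP; congr Posz; apply: eq_bigr => j _; rewrite ffunE /= unlift_none.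
    + by apply/eqP/ffunP => j; rewrite !ffunE /= unlift_none.
  - move=> /andP[_ /eqP cA]; apply/ffunP => -[i j]; rewrite !ffunE /=.
    by case: (unliftP ord0 j) => [s|] ->; rewrite ?ffunE // -cA ffunE.
  by move=> _; apply/ffunP => -[i j]; rewrite !ffunE /= liftK.
move=> A; rewrite inE => /andP[_ /forallP/(_ ord0)/eqP <-]; apply/eqP; congr Posz.
by apply: eq_bigr => j _; rewrite ffunE.
Qed.

(** Padding by zeros turns a finite shape into a function on [nat], so that shapes of different
    lengths can be compared. *)
Definition extend0 l B (v : {ffun 'I_l -> 'I_B}) (j : nat) : nat :=
  oapp (fun i : 'I_l => val (v i)) 0%N (insub j).

Lemma extend0E l B (v : {ffun 'I_l -> 'I_B}) (j : 'I_l) : extend0 v j = v j.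
Proof. by rewrite /extend0 valK. Qed.

Lemma extend0_ge l B (v : {ffun 'I_l -> 'I_B}) j : (l <= j)%N -> extend0 v j = 0%N.
Proof. by move=> lj; rewrite /extend0 insubN -?leqNgt. Qed.

(** Combines [tables_peel] with the strip rule: deleting a column of sum p from the tables removes a
    horizontal strip of p boxes from the shape. *)
Lemma alternate_tables_peel B l l' (la : nat -> nat) (b : {ffun 'I_l'.+1 -> int}) p :
    (forall j, la j.+1 <= la j)%N -> la l = 0%N -> (la 0 + l < B)%N ->
    b ord0 = Posz p ->
  alternate (fun a : {ffun 'I_l -> int} => Posz (tables B a b)) (jt_shift l la) =
  \sum_(v : {ffun 'I_l -> 'I_B} |
     [forall j : 'I_l, la j.+1 <= v j <= la j]%N &&
     ((\sum_j v j + p)%N == \sum_(j < l) la j)%N)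
    alternate (fun a : {ffun 'I_l -> int} => Posz (tables B a [ffun s => b (lift ord0 s)]))
      (jt_shift l (extend0 v)).
Proof.
move=> la_dec la_l ltB b0.
rewrite (eq_alternate _ (fun a => tables_peel B a b)) alternate_sum b0.
rewrite [RHS](eq_bigr (fun v : {ffun 'I_l -> 'I_B} => alternate
  (fun a : {ffun 'I_l -> int} => Posz (tables B a [ffun s => b (lift ord0 s)]))
      [ffun j : 'I_l => Posz (v j) - Posz j])) => [|v _]; last first.
  by congr (alternate _ _); apply/ffunP => j; rewrite !ffunE extend0E.
rewrite -(alternate_strip _ (@tables_sym _ _ _ _) (@tables_nonneg _ _ _ _)) //.
apply: eq_bigr => m _; apply: eq_bigr => s _; congr (_ * Posz (tables _ _ _)).
by apply/ffunP => j; rewrite !ffunE addrAC.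
Qed.

(** The inner product of the characters of shapes [la] and [mu], once the sum over S_n has been
    replaced by table counts ([sum_alternate]). *)
Definition jt_pair B l l' (la mu : nat -> nat) :=
  alternate (fun a : {ffun 'I_l -> int} =>
    alternate (fun b : {ffun 'I_l' -> int} => Posz (tables B a b)) (jt_shift l' mu)) (jt_shift l la).

Lemma alternateC l l' (f : {ffun 'I_l -> int} -> {ffun 'I_l' -> int} -> int)
    (x : {ffun 'I_l -> int}) (y : {ffun 'I_l' -> int}) :
  alternate (fun a => alternate (f a) y) x = alternate (fun b => alternate (f^~ b) x) y.
Proof.
rewrite /alternate; under eq_bigr do rewrite mulr_sumr.
rewrite exchange_big; apply: eq_bigr => s _; rewrite mulr_sumr.
by apply: eq_bigr => t _; rewrite mulrCA.
Qed.

Lemma jt_pairC B l l' la mu : jt_pair B l l' la mu = jt_pair B l' l mu la.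
Proof.
rewrite /jt_pair alternateC; apply: eq_alternate => b; apply: eq_alternate => a.
by rewrite tables_tr.
Qed.

Lemma sum_shift_nat l (la : nat -> nat) :
  (\sum_(j < l) la j + la l = la 0 + \sum_(j < l) la j.+1)%N.
Proof.
elim: l => [|l IH]; first by rewrite !big_ord0 addnC.
by rewrite !big_ord_recr /= IH addnA.
Qed.

(** A strip leaves at least la_(j+1) boxes in row j, hence at least |la| - la_0 boxes in all. *)
Lemma strip_bound l B (la : nat -> nat) (v : {ffun 'I_l -> 'I_B}) p : la l = 0%N ->
  [forall j : 'I_l, la j.+1 <= v j <= la j]%N &&
     ((\sum_j v j + p)%N == \sum_(j < l) la j)%N -> (p <= la 0)%N.
Proof.
move=> la_l /andP[/forallP vP /eqP sv]; have := sum_shift_nat l la.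
rewrite la_l addn0 -sv => sE.
have : (\sum_(j < l) la j.+1 <= \sum_(j < l) v j)%N.
  by apply: leq_sum => j _; case/andP: (vP j).
by move=> le_s; rewrite -(leq_add2l (\sum_j v j)%N) sE addnC leq_add2r.
Qed.

(** When la_0 boxes are removed no row has any slack, so what remains is [la] without its first
    row. *)
Lemma strip_bound_eq l B (la : nat -> nat) (v : {ffun 'I_l -> 'I_B}) p : la l = 0%N ->
  [forall j : 'I_l, la j.+1 <= v j <= la j]%N &&
     ((\sum_j v j + p)%N == \sum_(j < l) la j)%N -> p = la 0 ->
  forall j : 'I_l, v j = la j.+1 :> nat.
Proof.
move=> la_l /andP[/forallP vP /eqP sv] p0 j; have := sum_shift_nat l la.
rewrite la_l addn0 -sv p0 => sE.
have {}sE : (\sum_(j < l) v j = \sum_(j < l) la j.+1)%N.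
  by apply/eqP; rewrite -(eqn_add2r (la 0)) sE addnC eqxx.
apply/eqP; rewrite eqn_leq; have /andP[-> _] := vP j; rewrite andbT.
have : (\sum_(i < l | i != j) la i.+1 <= \sum_(i < l | i != j) v i)%N.
  by apply: leq_sum => i _; case/andP: (vP i).
move: sE; rewrite (bigD1 j) //= [X in _ = X -> _](bigD1 j) //= => sE' le_s.
by rewrite -(leq_add2r (\sum_(i < l | i != j) la i.+1)%N) -sE' leq_add2l.
Qed.

Lemma shape_perm0 l mu (s : 'S_l.+1) :
  [ffun j => jt_shift l.+1 mu j + Posz (s j)] ord0 = Posz (mu 0 + s ord0)%N.
Proof. by rewrite !ffunE subr0. Qed.

(** The first column of the tables has sum mu_0 + s(0) >= mu_0, too large for any strip of [la]. *)
Lemma jt_pair_gt0 B l l' la mu :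
    (forall j, la j.+1 <= la j)%N -> la l = 0%N -> (la 0 + l < B)%N ->
  (la 0 < mu 0)%N -> jt_pair B l l'.+1 la mu = 0.
Proof.
move=> la_dec la_l ltB lt0; rewrite /jt_pair alternateC; apply: big1 => s _.
rewrite (alternate_tables_peel la_dec la_l ltB (shape_perm0 _ _)) big_pred0 ?mulr0 // => v.
by apply/negP => /(strip_bound la_l); lia.
Qed.

(** Only permutations with s(0) = 0 leave a column sum as small as la_0, and then the strip is
    unique. Passing to the remaining columns lowers both the index j and s(j) by one, and these two
    changes cancel. *)
Lemma jt_pair_rec B l l' la mu :
    (forall j, la j.+1 <= la j)%N -> la l = 0%N -> (la 0 + l < B)%N ->
    mu 0 = la 0 ->
  jt_pair B l l'.+1 la mu = jt_pair B l l' (la \o succn) (mu \o succn).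
Proof.
move=> la_dec la_l ltB eq0; rewrite /jt_pair alternateC [RHS]alternateC.
rewrite {1}/alternate (bigID (fun s : 'S__ => s ord0 == ord0)) /= [X in _ + X]big1 ?addr0.
  rewrite big_lift_perm0; apply: eq_bigr => s _.
  rewrite odd_lift_perm addbb; congr (_ * _).
  rewrite (alternate_tables_peel la_dec la_l ltB (shape_perm0 _ _)).
  have vB j : (la j.+1 < B)%N.
    suff: (la j.+1 <= la 0)%N by lia.
    by elim: j => // j IH; apply: leq_trans (la_dec _) IH.
  pose v0 := [ffun j : 'I_l => Ordinal (vB j)].
  rewrite (big_pred1 v0) => [|v] /=; last first.
    rewrite lift_perm_id addn0 eq0; apply/idP/eqP => [vP|->].
      apply/ffunP => j; apply: val_inj; rewrite ffunE /=.
      exact: (strip_bound_eq la_l vP).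
    apply/andP; split; first by apply/forallP => j; rewrite ffunE /= leqnn la_dec.
    have := sum_shift_nat l la; rewrite la_l addn0 addnC => ->.
    by apply/eqP; congr (_ + _)%N; apply: eq_bigr => j _; rewrite ffunE.
  have -> : jt_shift l (extend0 v0) = jt_shift l (la \o succn).
    by apply/ffunP => j; rewrite !ffunE extend0E ffunE.
  apply: eq_alternate => a; congr (Posz (tables _ _ _)).
  apply/ffunP => j; rewrite !ffunE lift_perm_lift !lift0 /=.
  by move: (nat_of_ord j) (nat_of_ord (s j)) => p q; lia.
move=> s s0; rewrite (alternate_tables_peel la_dec la_l ltB (shape_perm0 _ _)).
rewrite big_pred0 ?mulr0 // => v; apply/negP => /(strip_bound la_l).
have: nat_of_ord (s ord0) != 0%N by rewrite -[0%N]/(nat_of_ord (ord0 : 'I_l'.+1)) val_eqE.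
rewrite eq0 -[X in (_ <= X)%N -> _]addn0 leq_add2l.
by case: (nat_of_ord _).
Qed.

(* Compare first rows. Peeling off the first column of the tables removes a
   horizontal strip, of size at most la_0, so the pairing vanishes if mu_0 > la_0,
   and by symmetry if mu_0 < la_0; if mu_0 = la_0 both first rows can be deleted. *)
Lemma jt_pair_ortho B l l' la mu (b : bool) :
    (forall j, la j.+1 <= la j)%N -> (forall j, l <= j -> la j = 0)%N ->
    (forall j, mu j.+1 <= mu j)%N -> (forall j, l' <= j -> mu j = 0)%N ->
    (la 0 + l < B)%N -> (mu 0 + l' < B)%N -> reflect (la =1 mu) b ->
  jt_pair B l l' la mu = b.
Proof.
have [n] := ubnP (l + l'); elim: n => // n IH in l l' la mu b *.
(* [jt_pair_rec] shortens only the second side, so l <= l' makes both sides empty in the base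
   case. *)
wlog : l l' la mu b / (l <= l')%N.
  move=> wl ltn la_dec la0 mu_dec mu0 laB muB bP.
  case/orP: (leq_total l l') => ll'; first exact: wl.
  rewrite jt_pairC; apply: wl => //; first by rewrite addnC.
  by apply: (iffP bP) => eq j; rewrite eq.
case: l' => [|l'] ll' ltn la_dec la0 mu_dec mu0 laB muB bP.
  move: ll' la0 laB ltn; rewrite leqn0 => /eqP -> la0 laB ltn.
  have -> : b by apply/bP => j; rewrite la0 ?mu0.
  rewrite /jt_pair /alternate; have S01 (s : 'S_0) : s = 1%g by apply/permP => -[].
  rewrite (big_pred1 1%g) => [|s]; last by rewrite (S01 s) /= eqxx.
  rewrite (big_pred1 1%g) => [|s]; last by rewrite (S01 s) /= eqxx.
  rewrite odd_perm1 !mul1r /tables; congr Posz.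
  rewrite (eq_card1 (x := [ffun p : 'I_0 * 'I_0 => match p.1 with Ordinal _ i => False_rect _ (notF i) end])) // => A.
  rewrite !inE; apply/andP/eqP => [_|_]; first by apply/ffunP => -[[]].
  by split; apply/forallP => -[].
have la_l : la l = 0%N by apply: la0.
have [lt0|gt0|eq0] := ltngtP (la 0) (mu 0).
- rewrite jt_pair_gt0 //; case: bP => // eq; move: lt0; rewrite eq; lia.
- case: l la0 la_l laB ltn ll' => [|l] la0 la_l laB ltn ll'; first by rewrite la_l in gt0.
  rewrite jt_pairC (jt_pair_gt0 _ mu_dec (mu0 _ (leqnn _)) muB gt0); case: bP => // eq; move: gt0; rewrite eq; lia.
rewrite jt_pair_rec //; apply: IH => //=.
- by move: ltn; rewrite addnS.
- by move=> j lj; rewrite la0 // leqW.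
- by move=> j lj; rewrite mu0.
- by apply: leq_ltn_trans laB; rewrite leq_add2r.
- by apply: leq_ltn_trans muB; rewrite leq_add // mu_dec.
apply: (iffP bP) => [eq j|eq [|j]]; [exact: eq|exact: eq0|exact: eq].
Qed.

(** Column 0 of the tables has the fixed sum p and is not alternated: this is the inner product of
    [la] with the character induced from [mu] times the trivial character of S_p. *)
Definition strip_pair B l l' p (la mu : nat -> nat) :=
  alternate (fun a : {ffun 'I_l -> int} =>
    alternate (fun b : {ffun 'I_l' -> int} => Posz (tables B a
        [ffun j => if unlift ord0 j is Some i then b i else Posz p])) (jt_shift l' mu)) (jt_shift l la).

(** Peeling column 0 turns the pairing into the sum of [jt_pair] over all v obtained from [la] by
    removing a strip of p boxes; orthonormality keeps only v = mu. *)
Lemma strip_pairE B l l' p la mu (b : bool) :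
    (forall j, la j.+1 <= la j)%N -> (forall j, l <= j -> la j = 0)%N ->
    (forall j, mu j.+1 <= mu j)%N -> (forall j, l' <= j -> mu j = 0)%N ->
    (la 0 + l < B)%N -> (mu 0 + l' < B)%N ->
    (\sum_(j < l) la j = p + \sum_(j < l') mu j)%N ->
    reflect (forall j, la j.+1 <= mu j <= la j)%N b ->
  strip_pair B l l' p la mu = b.
Proof.
move=> la_dec la0 mu_dec mu0 laB muB sE bP; have la_l : la l = 0%N by apply: la0.
pose strip (v : {ffun 'I_l -> 'I_B}) :=
     [forall j : 'I_l, la j.+1 <= v j <= la j]%N &&
     ((\sum_j v j + p)%N == \sum_(j < l) la j)%N.
have -> : strip_pair B l l' p la mu =
   \sum_(v | strip v) jt_pair B l l' (extend0 v) mu.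
  rewrite /strip_pair alternateC; under eq_alternate => b'.
    rewrite (@alternate_tables_peel _ _ _ _ _ p la_dec la_l laB); last by rewrite ffunE unlift_none.
    under eq_bigr => v _.
      rewrite (_ : [ffun s => _] = b'); last by apply/ffunP => j; rewrite !ffunE liftK.
      over.
    over.
  by rewrite alternate_sum; apply: eq_bigr => v _; rewrite -alternateC.
(* Both functions vanish from l + l' on, so finitely many comparisons decide their equality. *)
pose eqv (v : {ffun 'I_l -> 'I_B}) := all (fun j => extend0 v j == mu j) (iota 0 (l + l')).
have eqvP v : reflect (extend0 v =1 mu) (eqv v).
  apply: (iffP allP) => [H j|H j _]; last by rewrite H.
  have [lj|lj] := ltnP j (l + l'); first by apply/eqP/H; rewrite mem_iota.
  by rewrite extend0_ge ?mu0 //; lia.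
have stripE v : strip v -> jt_pair B l l' (extend0 v) mu = (eqv v : nat).
  case/andP=> /forallP vP _; apply: jt_pair_ortho => //.
  - move=> j; have [lj|lj] := ltnP j.+1 l; last by rewrite extend0_ge.
    rewrite (extend0E v (Ordinal lj)) (extend0E v (Ordinal (ltnW lj))).
    have /andP[_ le1] := vP (Ordinal lj); have /andP[le2 _] := vP (Ordinal (ltnW lj)).
    exact: leq_trans le1 le2.
  - by move=> j; apply: extend0_ge.
  have [l0|l0] := ltnP 0 l; last by rewrite extend0_ge //; lia.
  rewrite (extend0E v (Ordinal l0)); have /andP[_ /= le0] := vP (Ordinal l0); lia.
rewrite (eq_bigr _ stripE).
case: bP => [il|nil]; last first.
  apply: big1 => v /andP[/forallP vP _]; case: eqvP => // eqv'; case: nil => j.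
  have [lj|lj] := ltnP j l.
    by rewrite -eqv' (extend0E v (Ordinal lj)); apply: vP.
  by rewrite -eqv' extend0_ge // la0 // leqW.
have muB' j : (mu j < B)%N.
  suff: (mu j <= mu 0)%N by lia.
  by elim: j => // j; apply: leq_trans.
pose v0 := [ffun j : 'I_l => Ordinal (muB' j)].
have v0E : extend0 v0 =1 mu.
  move=> j; have [lj|lj] := ltnP j l; first by rewrite (extend0E v0 (Ordinal lj)) ffunE.
  by rewrite extend0_ge //; have /andP[_] := il j; rewrite la0 // leqn0 => /eqP.
have sv0 : strip v0.
  apply/andP; split; first by apply/forallP => j; rewrite ffunE.
  rewrite sE addnC; apply/eqP; congr (_ + _)%N.
  rewrite (eq_bigr (fun j : 'I_l => mu j)) => [|j _]; last by rewrite ffunE.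
  have sumE m k : (forall j, m <= j -> mu j = 0)%N -> (m <= k)%N ->
      (\sum_(j < m) mu j = \sum_(j < k) mu j)%N.
    move=> m0 mk; rewrite -(subnKC mk) big_split_ord /= [X in (_ + X)%N]big1 ?addn0 //.
    by move=> i _; rewrite m0 // leq_addr.
  rewrite (sumE l (l + l')) ?leq_addr // ?(sumE l' (l + l')) ?leq_addl //.
  by move=> j lj; rewrite -v0E extend0_ge.
rewrite (bigD1 v0) //= big1 => [|v /andP[_ neq]]; first by rewrite addr0; case: eqvP.
case: eqvP => // eqv'; case/eqP: neq; apply/ffunP => j; apply: val_inj.
by rewrite -[LHS]/(nat_of_ord (v j)) -extend0E eqv' -v0E extend0E.
Qed.

End Tables.

(** * Fixed colourings *)

Section Colourings.

Definition content n (U : finType) (e : {ffun 'I_n -> U}) (u : U) : nat :=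
  #|[set x | e x == u]|.

Lemma content_count n (U : finType) (e : {ffun 'I_n -> U}) u :
  content e u = count_mem u [seq e x | x <- enum 'I_n].
Proof. by rewrite /content cardE {1}/enum_mem size_filter count_map -enumT; apply: eq_count => x /=; rewrite inE. Qed.

Lemma content_comp_perm n (U : finType) (e : {ffun 'I_n -> U}) (g : 'S_n) u :
  content [ffun x => e (g x)] u = content e u.
Proof.
rewrite /content -[RHS](card_imset _ (@perm_inj _ g^-1%g)); apply: eq_card => x.
apply/idP/imsetP => [|[y ey ->]].
  by rewrite inE ffunE => ex; exists (g x); rewrite ?inE ?permK.
by move: ey; rewrite !inE ffunE permKV.
Qed.

(** Equal contents mean that the two lists of colours are rearrangements of each other; the
    rearrangement is the permutation sought. *)
Lemma eq_content_perm n (U : finType) (e e0 : {ffun 'I_n -> U}) :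
  content e =1 content e0 -> exists h : 'S_n, forall x, e x = e0 (h x).
Proof.
move=> eqC; pose t := [tuple e x | x < n]; pose t0 := [tuple e0 x | x < n].
have /tuple_permP[h hE] : perm_eq t t0.
  apply/allP => u _ /=; rewrite -!content_count; exact/eqP/eqC.
exists h => x; have := congr1 (fun s => nth (e x) s x) hE.
by rewrite -!tnth_nth !tnth_mktuple.
Qed.

Lemma content_exists n (U : finType) (A : U -> nat) :
  \sum_u A u = n -> exists e : {ffun 'I_n -> U}, content e =1 A.
Proof.
move=> sA; pose t := flatten [seq nseq (A u) u | u <- enum U].
have szt : size t == n.
  rewrite size_flatten /shape -map_comp sumnE big_map big_enum -sA /=.
  by apply/eqP; apply: eq_bigr => u _; rewrite /= size_nseq.
exists [ffun x => tnth (Tuple szt) x] => u; rewrite content_count.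
rewrite (eq_map (ffunE _)) map_tnth_enum /= count_flatten -map_comp sumnE big_map big_enum /=.
rewrite (bigD1 u) //= count_nseq /= eqxx mul1n big1 ?addn0 // => v vu.
by rewrite count_nseq /= (negPf vu).
Qed.

(* S_n is transitive on the colourings of given content: if e0 is one of them,
   then g |-> e0 o g counts pairs (e, g) with e o g = e up to translation. *)
Lemma burnside_content n (U : finType) B (P : {ffun U -> 'I_B.+1} -> bool) : n <= B ->
  \sum_(g : 'S_n) #|[set e : {ffun 'I_n -> U} |
      [forall x, e (g x) == e x] && P [ffun u => inord (content e u)]]| =
  n`! * #|[set A : {ffun U -> 'I_B.+1} | (\sum_u A u == n) && P A]|.
Proof.
(* Contents are at most n <= B, so [inord] does not truncate them. *)
move=> nB; pose C (e : {ffun 'I_n -> U}) : {ffun U -> 'I_B.+1} := [ffun u => inord (content e u)].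
have CE e u : C e u = content e u :> nat.
  by rewrite ffunE inordK // ltnS (leq_trans _ nB) // -[X in _ <= X]card_ord max_card.
have sumC e : \sum_u C e u = n.
  under eq_bigr do rewrite CE /content -sum1_card.
  rewrite -[RHS]card_ord -[RHS]sum1_card [RHS](partition_big e xpredT) //=.
  by apply: eq_bigr => u _; apply: eq_bigl => x; rewrite inE.
have fixA (A : {ffun U -> 'I_B.+1}) : \sum_u A u = n ->
    \sum_(e | C e == A) #|[set g : 'S_n | [forall x, e (g x) == e x]]| = n`!.
  move=> sA; have [e0 e0A] := content_exists sA.
  have Ce0 : C e0 = A by apply/ffunP => u; apply: val_inj; rewrite /= CE.
  pose T e := [set g : 'S_n | [forall x, e0 (g x) == e x]].
  transitivity (\sum_(e | C e == A) #|T e|).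
    apply: eq_bigr => e /eqP CeA.
    have [|h hE] := @eq_content_perm _ _ e e0.
      by move=> u; rewrite -!CE CeA Ce0.
    (* If e = e0 o h, right translation by h carries the permutations fixing e onto those g with e0
       o g = e. *)
    rewrite -(card_imset _ (mulIg h)); apply: eq_card => g.
    apply/imsetP/idP => [[g']|]; rewrite !inE.
      by move=> /forallP H ->; apply/forallP => x; rewrite permM -!hE.
    move=> /forallP H; exists (g * h^-1)%g; last by rewrite mulgKV.
    by rewrite inE; apply/forallP => x; rewrite hE permM permKV.
  rewrite -[RHS]card_Sn -sum1_card (partition_big (fun g : 'S_n => [ffun x => e0 (g x)]) (fun e => C e == A)).
    apply: eq_bigr => e _; rewrite -sum1_card; apply: eq_bigl => g; rewrite inE /=.
    apply/forallP/eqP => [H|<- x]; last by rewrite ffunE.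
    by apply/ffunP => x; rewrite ffunE; apply/eqP.
  move=> g _; rewrite -Ce0; apply/eqP/ffunP => u; apply: val_inj.
  by rewrite /= !CE content_comp_perm.
transitivity (\sum_(e | P (C e)) #|[set g : 'S_n | [forall x, e (g x) == e x]]|).
  transitivity (\sum_(g : 'S_n) \sum_(e : {ffun 'I_n -> U} | [forall x, e (g x) == e x] && P (C e)) 1).
    by apply: eq_bigr => g _; rewrite sum1dep_card.
  rewrite (exchange_big_dep (fun e => P (C e))) /= => [|g e _ /andP[] //].
  apply: eq_bigr => e Pe; rewrite -[RHS]sum1dep_card.
  by apply: eq_bigl => g; rewrite Pe andbT.
rewrite (partition_big C (fun A => (\sum_u A u == n) && P A)) => [|e Pe]; last first.
  by rewrite Pe andbT; apply/eqP/sumC.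
rewrite -[#|_|]sum1dep_card big_distrr /=; apply: eq_bigr => A /andP[/eqP sA PA]; rewrite muln1 -(fixA A sA).
by apply: eq_bigl => e; apply/andP/idP => [[]//|/eqP CA]; rewrite CA PA eqxx.
Qed.

Definition orbits_in n (g : 'S_n) (A : {set 'I_n}) : seq {set 'I_n} :=
  [seq c : {set 'I_n} <- enum (porbits g) | c \subset A].

Definition lens_in n (g : 'S_n) (A : {set 'I_n}) : seq nat :=
  [seq #|c| | c : {set 'I_n} <- orbits_in g A].

Lemma lens_inT n (g : 'S_n) : lens_in g setT = cyc_lens g.
Proof.
rewrite /lens_in /orbits_in (eq_filter (a2 := xpredT)) ?filter_predT // => c.
by rewrite subsetT.
Qed.

Definition stable n (g : 'S_n) (A : {set 'I_n}) := [forall x, (g x \in A) == (x \in A)].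

Lemma stableP n (g : 'S_n) (A : {set 'I_n}) :
  reflect (forall x, (g x \in A) = (x \in A)) (stable g A).
Proof. by apply: (iffP forallP) => H x; apply/eqP; apply: H. Qed.

Lemma stable_porbit n (g : 'S_n) (A : {set 'I_n}) x : stable g A -> x \in A ->
  porbit g x \subset A.
Proof.
move=> /stableP gA xA; apply/subsetP => y /porbitP[k ->].
by elim: k => [|k IH]; rewrite ?expg0 ?perm1 // expgSr permM gA.
Qed.

Lemma porbit_step n (g : 'S_n) x : porbit g (g x) = porbit g x.
Proof. by rewrite -[g x]/(aperm x g) -{2}(expg1 g) -[aperm x _]/((g ^+ 1)%g x) porbit_perm. Qed.

Lemma mem_orbits_in n (g : 'S_n) (A : {set 'I_n}) x : stable g A ->
  (porbit g x \in orbits_in g A) = (x \in A).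
Proof.
move=> gA; rewrite mem_filter mem_enum; apply/andP/idP => [[/subsetP sub _]|xA].
  by apply: sub; apply: porbit_id.
by split; [apply: stable_porbit | apply: imset_f].
Qed.

Lemma orbits_in_uniq n (g : 'S_n) A : uniq (orbits_in g A).
Proof. by rewrite filter_uniq // enum_uniq. Qed.

Lemma orbits_inP n (g : 'S_n) (A : {set 'I_n}) c : c \in orbits_in g A ->
  exists2 x, x \in A & c = porbit g x.
Proof.
rewrite mem_filter mem_enum => /andP[sub /imsetP[x _ cE]]; exists x => //.
by apply: (subsetP sub); rewrite cE porbit_id.
Qed.

(** A colouring invariant under [g] is constant on cycles, hence is a map from the list of cycles to
    the colours; [None] marks the points outside [A]. *)
Lemma pcoef_colour n (g : 'S_n) (A : {set 'I_n}) l (a : 'I_l -> int) : stable g A ->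
  pcoef (lens_in g A) a =
  #|[set e : {ffun 'I_n -> option 'I_l} | [forall x, e (g x) == e x] &&
     [forall x, (e x == None) == (x \notin A)] && [forall j, Posz (content e (Some j)) == a j]]|.
Proof.
move=> gA; set O := orbits_in g A; set mu := lens_in g A.
have szO : size mu = size O by rewrite size_map.
pose blk (k : 'I_(size mu)) := nth set0 O k.
have ltO (k : 'I_(size mu)) : k < size O by rewrite -szO.
pose oidx x : option 'I_(size mu) := insub (index (porbit g x) O).
have oidxP x k : (oidx x == Some k) = (x \in blk k).
  have blkO : blk k \in O by rewrite mem_nth.
  have [y yA blkE] := orbits_inP blkO.
  apply/eqP/idP => [|xk].
    rewrite /oidx; case: insubP => // k' lt_k k'E [<-].
    by rewrite /blk k'E nth_index ?porbit_id // -index_mem -szO.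
  have bx : porbit g x = blk k by apply/eqP; rewrite blkE eq_porbit_mem -blkE.
  by rewrite /oidx bx /blk index_uniq ?orbits_in_uniq ?ltO // valK.
have oidx_none x : (oidx x == None) = (x \notin A).
  rewrite -(mem_orbits_in x gA) -/O -index_mem /oidx -szO.
  by case: insubP => [k ->|/negPf ->].
have oidx_step x : oidx (g x) = oidx x by rewrite /oidx porbit_step.
pose ext (f : {ffun 'I_(size mu) -> 'I_l}) := [ffun x => omap f (oidx x)].
have content_ext f j : content (ext f) (Some j) = \sum_(k < size mu | f k == j) nth 0 mu k.
  transitivity (\sum_(k < size mu | f k == j) \sum_(x | x \in blk k) 1).
    rewrite /content -sum1_card (exchange_big_dep xpredT) //= big_mkcond /=.
    apply: eq_bigr => x _; rewrite inE ffunE; case E: (oidx x) => [k|] /=.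
      rewrite (eq_bigl (fun k' => (k' == k) && (f k == j))) => [|k'].
        case: (f k =P j) => [->|nk]; rewrite ?eqxx.
          by rewrite (eq_bigl (pred1 k)) ?big_pred1_eq // => k'; rewrite andbT.
        case: eqP => [[]//|_]; rewrite big_pred0 // => k'; by rewrite andbF.
      rewrite -oidxP E; case: (Some k =P Some k') => [[->]|nk]; first by rewrite eqxx andbT.
      by rewrite andbF; case: eqP => // kk; rewrite kk in nk.
    by rewrite big_pred0 // => k'; rewrite -oidxP E andbF.
  by apply: eq_bigr => k _; rewrite sum1_card (nth_map set0).
have ext_inj : injective ext.
  move=> f f' ff; apply/ffunP => k.
  have blkO : blk k \in O by rewrite mem_nth.
  have [y yA blkE] := orbits_inP blkO.
  have := congr1 (fun e : {ffun 'I_n -> option 'I_l} => e y) ff; rewrite !ffunE.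
  have /eqP -> : oidx y == Some k by rewrite oidxP blkE porbit_id.
  by case.
rewrite /pcoef -(card_imset _ ext_inj); apply: eq_card => e; rewrite inE.
apply/imsetP/idP => [[f]|].
  rewrite inE => /forallP H ->; apply/andP; split; first (apply/andP; split).
  - by apply/forallP => x; rewrite !ffunE oidx_step.
  - apply/forallP => x; rewrite ffunE -oidx_none; by case: (oidx x).
  - by apply/forallP => j; rewrite content_ext.
move=> /andP[/andP[/forallP einv /forallP enone] /forallP econt].
have [f fE] : exists f : {ffun 'I_(size mu) -> 'I_l}, forall k x, x \in blk k -> e x = Some (f k).
  have [f fE] : exists f, forall k x, x \in blk k -> e x = Some (f k).
    apply: (@fin_all_exists _ (fun=> 'I_l) (fun k j => forall x, x \in blk k -> e x = Some j)) => k.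
    have blkO : blk k \in O by rewrite mem_nth.
    have [y yA blkE] := orbits_inP blkO.
    case ey: (e y) => [j|]; last by have := enone y; rewrite ey yA.
    exists j => x; rewrite blkE => /porbitP[i ->]; rewrite -ey.
    by elim: i => [|i IH]; rewrite ?expg0 ?perm1 // expgSr permM (eqP (einv _)).
  by exists (finfun f) => k x xk; rewrite ffunE; apply: fE.
have eE : e = ext f.
  apply/ffunP => x; rewrite ffunE; case E: (oidx x) => [k|] /=.
    by apply: fE; rewrite -oidxP E.
  by have := enone x; rewrite -oidx_none E eqxx eqb_id => /eqP.
by exists f => //; rewrite inE; apply/forallP => j; rewrite -content_ext -eE.
Qed.

Lemma pcoef_colourT n (g : 'S_n) l (a : 'I_l -> int) :
  pcoef (cyc_lens g) a =
  #|[set e : {ffun 'I_n -> 'I_l} | [forall x, e (g x) == e x] &&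
     [forall j, Posz (content e j) == a j]]|.
Proof.
have gT : stable g setT by apply/stableP => x; rewrite !inE.
rewrite -lens_inT (pcoef_colour _ gT).
pose ext (e : {ffun 'I_n -> 'I_l}) := [ffun x => Some (e x)].
have ext_inj : injective ext.
  move=> e e' ee; apply/ffunP => x.
  by have := congr1 (fun e : {ffun 'I_n -> option 'I_l} => e x) ee; rewrite !ffunE => -[].
have contE e j : content (ext e) (Some j) = content e j.
  by rewrite /content; apply: eq_card => x; rewrite !inE ffunE.
rewrite -[RHS](card_imset _ ext_inj); apply: eq_card => e; rewrite inE.
apply/idP/imsetP => [/andP[/andP[/forallP einv /forallP enone] /forallP econt]|[f]].
  have [f fE] : exists f, forall x, e x = Some (f x).
    apply: (@fin_all_exists _ (fun=> 'I_l) (fun x j => e x = Some j)) => x.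
    by case ex: (e x) => [j|]; [exists j | have := enone x; rewrite ex inE].
  have eE : e = ext (finfun f) by apply/ffunP => x; rewrite !ffunE.
  exists (finfun f) => //; rewrite inE; apply/andP; split.
    by apply/forallP => x; have := einv x; rewrite !fE !ffunE.
  by apply/forallP => j; rewrite -contE -eE.
rewrite inE => /andP[/forallP finv /forallP fcont] ->; apply/andP; split; first (apply/andP; split).
- by apply/forallP => x; rewrite !ffunE (eqP (finv x)).
- by apply/forallP => x; rewrite ffunE inE.
- by apply/forallP => j; rewrite contE.
Qed.

(** A pair of invariant colourings is one invariant colouring by pairs of colours, whose content is
    a table with margins [a] and [b]; [burnside_content] then counts. *)
Lemma sum_pcoefM n B l l' (a : {ffun 'I_l -> int}) (b : {ffun 'I_l' -> int}) :
    n <= B -> (\sum_j a j = Posz n)%R ->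
  \sum_(g : 'S_n) pcoef (cyc_lens g) a * pcoef (cyc_lens g) b = n`! * tables B.+1 a b.
Proof.
move=> nB sa; pose P (A : {ffun 'I_l * 'I_l' -> 'I_B.+1}) :=
  [forall j, Posz (\sum_s A (j, s)) == a j] && [forall s, Posz (\sum_j A (j, s)) == b s].
have -> : tables B.+1 a b =
    #|[set A : {ffun 'I_l * 'I_l' -> 'I_B.+1} | (\sum_u A u == n) && P A]|.
  apply: eq_card => A; rewrite !inE -/(P A); case PA: (P A); rewrite ?andbF //.
  rewrite andbT; apply/esym/eqP; case/andP: PA => /forallP PA _.
  have : Posz (\sum_u A u) = Posz n; last by case.
  rewrite -sa -[LHS]natz (eq_bigr (fun u => nat_of_ord (A (u.1, u.2)))) => [|[] //].
  rewrite -(pair_bigA _ (fun j s => nat_of_ord (A (j, s)))) /= natr_sum.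
  by apply: eq_bigr => j _; rewrite natz; apply/eqP.
rewrite -(burnside_content _ nB); apply: eq_bigr => g _.
rewrite !pcoef_colourT -cardsX.
pose h (p : {ffun 'I_n -> 'I_l} * {ffun 'I_n -> 'I_l'}) : {ffun 'I_n -> 'I_l * 'I_l'} :=
  [ffun x => (p.1 x, p.2 x)].
pose h' (e : {ffun 'I_n -> 'I_l * 'I_l'}) : {ffun 'I_n -> 'I_l} * {ffun 'I_n -> 'I_l'} :=
  ([ffun x => (e x).1], [ffun x => (e x).2]).
have hK : cancel h h' by move=> [e f]; congr (_, _); apply/ffunP => x; rewrite !ffunE.
have h'K : cancel h' h by move=> e; apply/ffunP => x; rewrite !ffunE; case: (e x).
have CE (e : {ffun 'I_n -> 'I_l * 'I_l'}) u :
    [ffun u => inord (content e u) : 'I_B.+1] u = content e u :> nat.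
  by rewrite ffunE inordK // ltnS (leq_trans _ nB) // -[X in _ <= X]card_ord max_card.
have C1 e j : \sum_s [ffun u => inord (content e u) : 'I_B.+1] (j, s) = content (h' e).1 j.
  under eq_bigr do rewrite CE /content -sum1_card.
  rewrite /content -[RHS]sum1_card [RHS](partition_big (fun x => (e x).2) xpredT) //=.
  apply: eq_bigr => s _; apply: eq_bigl => x; rewrite !inE ffunE.
  by case: (e x).
have C2 e s : \sum_j [ffun u => inord (content e u) : 'I_B.+1] (j, s) = content (h' e).2 s.
  under eq_bigr do rewrite CE /content -sum1_card.
  rewrite /content -[RHS]sum1_card [RHS](partition_big (fun x => (e x).1) xpredT) //=.
  apply: eq_bigr => j _; apply: eq_bigl => x; rewrite !inE ffunE.
  by case: (e x) => u v; rewrite -pair_eqE /= andbC.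
have main e : (h' e \in setX [set e : {ffun 'I_n -> 'I_l} | [forall x, e (g x) == e x] &&
     [forall j, Posz (content e j) == a j]] [set e : {ffun 'I_n -> 'I_l'} | [forall x, e (g x) == e x] &&
     [forall j, Posz (content e j) == b j]]) = ([forall x, e (g x) == e x] && P [ffun u => inord (content e u)]).
  rewrite !inE /=; have -> : P [ffun u => inord (content e u)] =
    [forall j, Posz (content (h' e).1 j) == a j] && [forall j, Posz (content (h' e).2 j) == b j].
    by congr (_ && _); apply: eq_forallb => j; rewrite ?C1 ?C2.
  have -> : [forall x, e (g x) == e x] =
    [forall x, (h' e).1 (g x) == (h' e).1 x] && [forall x, (h' e).2 (g x) == (h' e).2 x].
    apply/forallP/andP => [H|[/forallP H1 /forallP H2] x].
      by split; apply/forallP => x; rewrite !ffunE (eqP (H x)).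
    by rewrite -pair_eqE /=; have := H1 x; have := H2 x; rewrite !ffunE => -> ->.
  by rewrite /= -!andbA; do !bool_congr.
apply: (@eq_card_bij _ _ h h') => e; rewrite ?hK ?h'K //.
  by move=> eX; rewrite inE -main hK.
by rewrite inE -main.
Qed.

End Colourings.

(** * Irreducible characters *)

Section Partitions.

(** In a decreasing list the zeros come last, and 0 is the default value of [nth], so deleting them
    is invisible. *)
Lemma nth_filter_pos s i : sorted geq s ->
  nth 0 [seq x <- s | 0 < x] i = nth 0 s i.
Proof.
elim: s i => [|[|x] s IH] i //= srt; last by case: i => //= i; apply: IH (path_sorted srt).
have s0 : all (geq 0) s by apply: order_path_min srt => a b c /= ab bc; apply: leq_trans bc ab.
rewrite (eq_in_filter (a2 := pred0)) => [|y /(allP s0)] /=; last by case: y.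
rewrite filter_pred0 nth_nil; case: i => //= i; elim: s s0 i {IH srt} => [|[|//] s IH] s0 [] //=.
by apply: IH.
Qed.

Lemma sorted_geq_nth s : sorted geq s -> forall i j, i <= j -> nth 0 s j <= nth 0 s i.
Proof.
move=> srt i j ij; have [js|js] := ltnP j (size s); last by rewrite nth_default.
move: ij; rewrite leq_eqVlt => /predU1P[->|ij] //.
apply: (@sorted_ltn_nth _ geq _ 0 s srt) => //; rewrite ?inE //.
- by move=> a b c /= ab bc; apply: leq_trans bc ab.
- exact: ltn_trans js.
Qed.

Lemma sum_nth_sumn s : \sum_(j < size s) nth 0 s j = sumn s.
Proof. by rewrite sumnE (big_nth 0) big_mkord. Qed.

Lemma sum_nth_le m s : size s <= m -> \sum_(i < m) nth 0 s i = sumn s.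
Proof.
move=> sm; rewrite -(subnKC sm) big_split_ord /= sum_nth_sumn big1 ?addn0 // => i _.
by rewrite nth_default // leq_addr.
Qed.

Definition parts_seq n (t : {ffun 'I_n -> 'I_n.+1}) : seq nat :=
  [seq val (t i) | i <- enum 'I_n].

Lemma nth_parts_seq n (t : {ffun 'I_n -> 'I_n.+1}) (i : 'I_n) :
  nth 0 (parts_seq t) i = t i.
Proof. by rewrite (nth_map i) ?size_enum_ord // nth_ord_enum. Qed.

Lemma sumn_parts_seq n (t : {ffun 'I_n -> 'I_n.+1}) : sumn (parts_seq t) = \sum_i t i.
Proof. by rewrite sumnE big_map big_enum. Qed.

Lemma sorted_parts_seq n (t : {ffun 'I_n -> 'I_n.+1}) : is_part t -> sorted geq (parts_seq t).
Proof.
move=> /andP[/forallP dec _]; apply/(sortedP 0) => i; rewrite size_map size_enum_ord => lti.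
rewrite (nth_parts_seq t (Ordinal lti)) (nth_parts_seq t (Ordinal (ltnW lti))) /=.
by have /forallP/(_ (Ordinal lti))/implyP := dec (Ordinal (ltnW lti)); apply.
Qed.

Lemma sumn_filter_pos s : sumn [seq x <- s | 0 < x] = sumn s.
Proof. by elim: s => //= -[|x] s IH //=; rewrite IH. Qed.

Lemma size_le_sumn s : all (fun x => 0 < x) s -> size s <= sumn s.
Proof. by elim: s => //= x s IH /andP[x0 /IH]; lia. Qed.

Lemma nth_le_sumn s i : nth 0 s i <= sumn s.
Proof. by elim: s i => [|x s IH] [|i] //=; [rewrite leq_addr | have := IH i; lia]. Qed.

Lemma eq_from_nth0 s s' : all (fun x => 0 < x) s -> all (fun x => 0 < x) s' ->
  nth 0 s =1 nth 0 s' -> s = s'.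
Proof.
elim: s s' => [|x s IH] [|x' s'] //=.
- by move=> _ /andP[x0 _] /(_ 0) /= xE; rewrite -xE in x0.
- by move=> /andP[x0 _] _ /(_ 0) /= xE; rewrite xE in x0.
move=> /andP[_ sp] /andP[_ sp'] eqn; congr (_ :: _); first exact: (eqn 0).
by apply: IH => // i; apply: (eqn i.+1).
Qed.

Lemma mem_partitions n la :
  (la \in partitions n) = [&& sorted geq la, all (fun x => 0 < x) la & sumn la == n].
Proof.
apply/mapP/and3P => [[t]|[srt pos /eqP sla]].
  rewrite mem_filter => /andP[tp _] ->; rewrite -/(parts_seq t).
  split; last by rewrite sumn_filter_pos sumn_parts_seq; case/andP: tp.
    apply: sorted_filter; last exact: sorted_parts_seq.
    by move=> a b c /= ab bc; apply: leq_trans bc ab.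
  exact: filter_all.
pose t : {ffun 'I_n -> 'I_n.+1} := [ffun i : 'I_n => inord (nth 0 la i)].
have tE i : t i = nth 0 la i :> nat.
  by rewrite ffunE inordK // ltnS; apply: leq_trans (nth_le_sumn _ _) _; rewrite sla.
have szla : size la <= n by rewrite -sla size_le_sumn.
have tp : is_part t.
  apply/andP; split.
    apply/forallP => i; apply/forallP => j; apply/implyP => ij.
    by rewrite /= !tE sorted_geq_nth.
  under eq_bigr do rewrite /= tE.
  by rewrite sum_nth_le // sla.
exists t; first by rewrite mem_filter tp mem_enum.
rewrite -/(parts_seq t); apply: eq_from_nth0 => //; first exact: filter_all.
move=> i; rewrite nth_filter_pos ?sorted_parts_seq //.
have [lti|lei] := ltnP i n; first by rewrite (nth_parts_seq t (Ordinal lti)) tE.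
by rewrite (nth_default _ (leq_trans szla lei)) nth_default // size_map size_enum_ord.
Qed.

Lemma partitions_uniq n : uniq (partitions n).
Proof.
rewrite map_inj_in_uniq; first by apply/filter_uniq/enum_uniq.
move=> t t'.
rewrite !mem_filter => /andP[tp _] /andP[tp' _] eq; apply/ffunP => i; apply: val_inj.
rewrite /= -!nth_parts_seq -nth_filter_pos ?sorted_parts_seq //.
by rewrite -[RHS]nth_filter_pos ?sorted_parts_seq // /parts_seq eq.
Qed.

(** Collects the hypotheses of [jt_pair_ortho]; by the last bound, table entries ranging up to 2n
    are enough. *)
Lemma partitions_shape n la : la \in partitions n ->
  [/\ forall j, nth 0 la j.+1 <= nth 0 la j, forall j, size la <= j -> nth 0 la j = 0,
      \sum_(j < size la) nth 0 la j = n & nth 0 la 0 + size la <= n + n].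
Proof.
rewrite mem_partitions => /and3P[srt pos /eqP sla]; split.
- by move=> j; apply: sorted_geq_nth.
- by move=> j; apply: nth_default.
- by rewrite sum_nth_sumn.
by rewrite leq_add // -sla ?nth_le_sumn // size_le_sumn.
Qed.

Lemma sumn_cyc_lens n (g : 'S_n) : sumn (cyc_lens g) = n.
Proof.
rewrite sumnE big_map big_enum /= -[RHS]card_ord -[RHS]sum1_card.
rewrite [RHS](partition_big (porbit g) (mem (porbits g))) => [|x _]; last exact: imset_f.
apply: eq_bigr => c /imsetP[y _ ->]; rewrite -sum1_card.
by apply: eq_bigl => x; rewrite -eq_porbit_mem.
Qed.

Definition cycle_type n (g : 'S_n) : seq nat := sort geq (cyc_lens g).

Lemma cycle_type_partition n (g : 'S_n) : cycle_type g \in partitions n.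
Proof.
rewrite mem_partitions sort_sorted ?all_sort; last by move=> x y; apply: leq_total.
rewrite (perm_sumn (_ : perm_eq _ (cyc_lens g))) ?perm_sort //.
rewrite sumn_cyc_lens eqxx andbT /=; apply/allP => x /mapP[c].
by rewrite mem_enum => /imsetP[y _ ->] ->; rewrite lt0n card_porbit_neq0.
Qed.

End Partitions.

(** * Orthogonality and completeness of the characters *)

Section Characters.
Local Open Scope ring_scope.

Lemma eq_pcoef mu l (a a' : 'I_l -> int) : a =1 a' -> pcoef mu a = pcoef mu a'.
Proof.
by move=> aa; apply: eq_card => f; rewrite !inE; apply: eq_forallb => j; rewrite aa.
Qed.

Lemma pcoefE mu m l (a : 'I_l -> int) : size mu = m ->
  pcoef mu a = #|[set f : {ffun 'I_m -> 'I_l} |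
    [forall j, Posz (\sum_(k < m | f k == j) nth 0%N mu k)%N == a j]]|.
Proof. by move=> <-. Qed.

Lemma pcoef_perm mu nu l (a : 'I_l -> int) : perm_eq mu nu -> pcoef mu a = pcoef nu a.
Proof.
move=> pmn; have szE := perm_size pmn; have sz : size nu == size mu by rewrite szE.
have /tuple_permP[p pE] : perm_eq mu (Tuple sz) by [].
have nthE (i : 'I_(size mu)) : nth 0%N mu i = nth 0%N nu (p i).
  have := congr1 (fun s => nth 0%N s i) pE; rewrite /= => ->.
  by rewrite -(tnth_nth _ [tuple tnth (Tuple sz) (p i) | i < size mu] i) tnth_mktuple (tnth_nth 0%N).
rewrite (pcoefE _ (erefl (size mu))) (pcoefE _ (eqP sz)).
have hom (q : 'S_(size mu)) s t (f : {ffun 'I_(size mu) -> 'I_l}) :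
    (forall i : 'I_(size mu), nth 0%N s i = nth 0%N t (q i)) ->
  f \in [set f : {ffun 'I_(size mu) -> 'I_l} |
     [forall j, Posz (\sum_(k < size mu | f k == j) nth 0%N t k)%N == a j]] ->
  [ffun k => f (q k)] \in [set f : {ffun 'I_(size mu) -> 'I_l} |
     [forall j, Posz (\sum_(k < size mu | f k == j) nth 0%N s k)%N == a j]].
  move=> qE; rewrite !inE => /forallP H; apply/forallP => j; rewrite -(eqP (H j)).
  rewrite [X in _ == Posz X](reindex_inj (@perm_inj _ q)); apply/eqP; congr Posz.
  by apply: eq_big => [k|k _]; rewrite ?ffunE.
apply: (@eq_card_bij _ _
  (fun f : {ffun 'I_(size mu) -> 'I_l} => [ffun k => f (p^-1%g k)] : {ffun 'I_(size mu) -> 'I_l})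
  (fun f : {ffun 'I_(size mu) -> 'I_l} => [ffun k => f (p k)] : {ffun 'I_(size mu) -> 'I_l})) => f.
- by apply: hom => i; rewrite nthE permKV.
- exact: hom.
- by move=> _; apply/ffunP => k; rewrite !ffunE permK.
- by move=> _; apply/ffunP => k; rewrite !ffunE permKV.
Qed.

(** The character value on cycle type [nu], with no reference to a permutation; it can therefore be
    evaluated on the cycles inside a subset. *)
Definition chi (la nu : seq nat) : int :=
  alternate (fun a : {ffun 'I_(size la) -> int} => Posz (pcoef nu a))
    (jt_shift (size la) (nth 0%N la)).

Lemma irr_charE n la (g : 'S_n) : irr_char la g = chi la (cyc_lens g).
Proof.
apply: eq_bigr => s _; congr (_ * Posz _); apply: eq_pcoef => j.
by rewrite !ffunE.
Qed.

Lemma chi_perm la nu nu' : perm_eq nu nu' -> chi la nu = chi la nu'.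
Proof. by move=> p; apply: eq_alternate => a; rewrite (pcoef_perm _ p). Qed.

Lemma irr_char_type n la (g : 'S_n) : irr_char la g = chi la (cycle_type g).
Proof. by rewrite irr_charE; apply: chi_perm; rewrite perm_sym perm_sort. Qed.

(** [phi] is the identity for irreducible characters and prepends a fixed part for induced ones.
    Each [s] adds the sum of all j < l to the total of [x], so the hypothesis gives every argument
    the total n that [sum_pcoefM] requires. *)
Lemma sum_alternate n B l l' l'' (phi : {ffun 'I_l' -> int} -> {ffun 'I_l'' -> int})
    (x : {ffun 'I_l -> int}) (y : {ffun 'I_l' -> int}) :
    (n <= B)%N -> \sum_j x j + Posz (\sum_(j < l) j)%N = Posz n ->
  \sum_(g : 'S_n) alternate (fun a : {ffun 'I_l -> int} => Posz (pcoef (cyc_lens g) a)) x *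
     alternate (fun b => Posz (pcoef (cyc_lens g) (phi b))) y =
  Posz n`! * alternate (fun a =>
    alternate (fun b => Posz (tables B.+1 a (phi b))) y) x.
Proof.
move=> nB sx; rewrite mulr_sumr; under eq_bigr do rewrite mulr_suml.
rewrite exchange_big; apply: eq_bigr => s _ /=.
rewrite [RHS]mulrCA [X in _ = _ * X]mulr_sumr [RHS]mulr_sumr.
under eq_bigr do rewrite mulr_sumr; rewrite exchange_big; apply: eq_bigr => t _ /=.
rewrite [X in _ = _ * X]mulrCA -PoszM -(sum_pcoefM _ nB); last first.
  under eq_bigr do rewrite ffunE.
  rewrite big_split /= -sx; congr (_ + _).
  rewrite -[RHS]natz natr_sum (reindex_inj (@perm_inj _ s^-1%g)) /=.
  by apply: eq_bigr => j _; rewrite permKV natz.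
rewrite -[X in _ = _ * (_ * X)]natz natr_sum !mulr_sumr; apply: eq_bigr => g _.
by rewrite natz PoszM mulrACA -!mulrA.
Qed.

Lemma jt_shift_sum l (la : nat -> nat) :
  \sum_j jt_shift l la j + Posz (\sum_(j < l) j)%N = Posz (\sum_(j < l) la j)%N.
Proof.
rewrite -[X in _ + X]natz -[RHS]natz !natr_sum -big_split /=.
by apply: eq_bigr => j _; rewrite ffunE !natz subrK.
Qed.

Lemma irr_char_ortho n la mu : la \in partitions n -> mu \in partitions n ->
  \sum_(g : 'S_n) irr_char la g * irr_char mu g = Posz (n`! * (la == mu))%N.
Proof.
move=> lap mup; have [la_dec la0 sla laB] := partitions_shape lap.
have [mu_dec mu0 smu muB] := partitions_shape mup.
under eq_bigr do rewrite !irr_charE.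
rewrite (@sum_alternate n (n + n) _ _ _ id) ?leq_addr //; last by rewrite jt_shift_sum sla.
rewrite PoszM; congr (_ * _); apply: (@jt_pair_ortho _ _ _ (nth 0%N la) (nth 0%N mu)) => //.
apply: (iffP eqP) => [->//|eq].
move: lap mup; rewrite !mem_partitions => /and3P[_ p1 _] /and3P[_ p2 _].
exact: eq_from_nth0.
Qed.

Definition type_weight n (nu : seq nat) : rat :=
  #|[set g : 'S_n | cycle_type g == nu]|%:R / n`!%:R.

Lemma factr_neq0 n : n`!%:R != 0 :> rat.
Proof. by rewrite pnatr_eq0 -lt0n fact_gt0. Qed.

Lemma sum_type n (F : seq nat -> rat) :
  \sum_(nu <- partitions n) F nu * type_weight n nu =
  (\sum_(g : 'S_n) F (cycle_type g)) / n`!%:R.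
Proof.
transitivity (\sum_(nu <- partitions n) \sum_(g : 'S_n | cycle_type g == nu)
   F (cycle_type g) / n`!%:R).
  apply: eq_bigr => nu _; rewrite /type_weight -sum1_card natr_sum mulr_suml mulr_sumr.
  rewrite (eq_bigl (fun g : 'S_n => cycle_type g == nu)) => [|g]; last by rewrite inE.
  by apply: eq_bigr => g /eqP ->; rewrite mul1r.
rewrite (exchange_big_dep xpredT) //= mulr_suml; apply: eq_bigr => g _.
rewrite -big_filter (_ : filter _ _ = [:: cycle_type g]) ?big_seq1 //.
rewrite (eq_filter (a2 := pred1 (cycle_type g))) => [|nu] /=; last by rewrite eq_sym.
by rewrite filter_pred1_uniq ?partitions_uniq ?cycle_type_partition.
Qed.

(* Row orthogonality reads X *m Y = 1 for square matrices, hence Y *m X = 1. *)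
Lemma chi_column_ortho n nu nu' : nu \in partitions n -> nu' \in partitions n ->
  \sum_(la <- partitions n) (chi la nu)%:~R * (chi la nu')%:~R * type_weight n nu' =
  (nu == nu')%:R :> rat.
Proof.
set ps := partitions n => nup nup'; pose N := size ps.
pose X : 'M[rat]_N := \matrix_(i, j) (chi (nth [::] ps i) (nth [::] ps j))%:~R.
pose Y : 'M[rat]_N := \matrix_(j, i)
  ((chi (nth [::] ps i) (nth [::] ps j))%:~R * type_weight n (nth [::] ps j)).
have big_ps (F : seq nat -> rat) : \sum_(la <- ps) F la = \sum_(i < N) F (nth [::] ps i).
  by rewrite (big_nth [::]) big_mkord.
have XY : X *m Y = 1%:M.
  apply/matrixP => i i'; rewrite !mxE.
  transitivity ((\sum_(g : 'S_n) (irr_char (nth [::] ps i) g *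
       irr_char (nth [::] ps i') g))%:~R / n`!%:R : rat).
    rewrite rmorph_sum /=; under [X in _ = X / _]eq_bigr do rewrite !irr_char_type.
    rewrite -(sum_type n (fun nu => (chi (nth [::] ps i) nu * chi (nth [::] ps i') nu)%:~R)).
    by rewrite big_ps; apply: eq_bigr => j _; rewrite !mxE mulrA intrM.
  rewrite irr_char_ortho ?mem_nth // nth_uniq ?partitions_uniq // PoszM intrM.
  by rewrite mulrAC -pmulrn divff ?factr_neq0 // mul1r val_eqE; case: eqP.
have iP : (index nu ps < N)%N by rewrite index_mem.
have iP' : (index nu' ps < N)%N by rewrite index_mem.
have := congr1 (fun M : 'M_N => M (Ordinal iP') (Ordinal iP)) (mulmx1C XY).
rewrite !mxE -val_eqE /= => E; rewrite big_ps.
rewrite (_ : (nu == nu') = (index nu' ps == index nu ps)); last first.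
  by apply/eqP/eqP => [->//|eqi]; rewrite -(nth_index [::] nup) -eqi nth_index.
rewrite -E; apply: eq_bigr => j _; rewrite !mxE !nth_index //.
ring.
Qed.

(** If the class were empty, its weight would be 0 and column orthogonality would read 0 = 1. *)
Lemma type_exists n nu : nu \in partitions n -> exists g : 'S_n, cycle_type g = nu.
Proof.
move=> nup; have := chi_column_ortho nup nup; rewrite eqxx /type_weight.
case: (set_0Vmem [set g : 'S_n | cycle_type g == nu]) => [->|[g]].
  by rewrite cards0 mul0r big1 => [/eqP|la _]; rewrite ?mulr0 // eq_sym oner_eq0.
by rewrite inE => /eqP gE _; exists g.
Qed.

(** By column orthogonality, the weighted sum over all characters of chi(g) chi(nu) is the indicator
    of the cycle type of g; summing [phi] against it returns the value at g. *)
Lemma class_fun_expansion n (phi : 'S_n -> rat) :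
    (forall g h, cycle_type g = cycle_type h -> phi g = phi h) ->
  forall g, phi g = \sum_(la <- partitions n)
    ((\sum_h phi h * (irr_char la h)%:~R) / n`!%:R) * (irr_char la g)%:~R.
Proof.
move=> phi_class g.
(* [phi] as a function of the cycle type, through a representative; the default 0 is never met on
   the type of a permutation. *)
pose F nu := if [pick h : 'S_n | cycle_type h == nu] is Some h then phi h else 0.
have FE h : phi h = F (cycle_type h).
  rewrite /F; case: pickP => [h' /eqP hE|/(_ h)]; first exact: phi_class.
  by rewrite eqxx.
transitivity (\sum_(la <- partitions n) \sum_(nu <- partitions n)
    F nu * ((chi la (cycle_type g))%:~R * (chi la nu)%:~R * type_weight n nu)); last first.
  apply: eq_bigr => la _; rewrite irr_char_type.
  under [X in _ = X / _ * _]eq_bigr do rewrite FE irr_char_type.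
  rewrite -(sum_type n (fun nu => F nu * (chi la nu)%:~R)) mulr_suml.
  by apply: eq_bigr => nu _; ring.
rewrite exchange_big /= FE big_seq.
under eq_bigr => nu nup do rewrite -mulr_sumr chi_column_ortho ?cycle_type_partition //.
rewrite -big_seq (bigD1_seq (cycle_type g)) ?cycle_type_partition ?partitions_uniq //=.
rewrite eqxx mulr1 big1 ?addr0 // => nu; rewrite eq_sym => /negPf ->.
by rewrite mulr0.
Qed.

End Characters.

(** * Set partitions *)

Section SetPartitions.

Lemma setpart_pblock n (P : {set {set 'I_n}}) x : P \in setpart n -> pblock P x \in P.
Proof. by rewrite inE => /and3P[/eqP cov _ _]; rewrite pblock_mem // cov inE. Qed.

Lemma mem_setpart_pblock n (P : {set {set 'I_n}}) x : P \in setpart n -> x \in pblock P x.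
Proof. by rewrite inE => /and3P[/eqP cov _ _]; rewrite mem_pblock cov inE. Qed.

Lemma setpart_def_pblock n (P : {set {set 'I_n}}) B x :
  P \in setpart n -> B \in P -> x \in B -> pblock P x = B.
Proof. by rewrite inE => /and3P[_ triv _]; apply: def_pblock. Qed.

Lemma setpart_same_pblock n (P : {set {set 'I_n}}) x y :
  P \in setpart n -> y \in pblock P x -> pblock P y = pblock P x.
Proof. by move=> Pp; apply: setpart_def_pblock; rewrite ?setpart_pblock. Qed.

Lemma setpartE n (P : {set {set 'I_n}}) : P \in setpart n -> P = [set pblock P x | x : 'I_n].
Proof.
move=> Pp; apply/setP => B; apply/idP/imsetP => [BP|[x _ ->]]; last exact: setpart_pblock.
have /set0Pn[x xB] : B != set0 by apply: partition_neq0 BP; rewrite inE in Pp; apply: Pp.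
by exists x; rewrite // (setpart_def_pblock Pp BP xB).
Qed.

Lemma eq_setpart n (P Q : {set {set 'I_n}}) : P \in setpart n -> Q \in setpart n ->
  pblock P =1 pblock Q -> P = Q.
Proof.
by move=> Pp Qp eq; rewrite (setpartE Pp) (setpartE Qp); apply: eq_imset.
Qed.

(** The hypotheses say that the sets [f x] are the classes of an equivalence relation. Set
    partitions are constructed in this way below and then handled through their block maps. *)
Lemma setpart_of_blocks n (f : 'I_n -> {set 'I_n}) :
    (forall x, x \in f x) -> (forall x y, y \in f x -> f y = f x) ->
  [set f x | x : 'I_n] \in setpart n /\ pblock [set f x | x : 'I_n] =1 f.
Proof.
move=> f_refl f_same; set P := [set _ | _ in _].
have Pp : P \in setpart n.
  rewrite inE; apply/and3P; split.
  - apply/eqP/setP => x; rewrite inE; apply/bigcupP; exists (f x) => //.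
    exact: imset_f.
  - apply/trivIsetP => _ _ /imsetP[x _ ->] /imsetP[y _ ->]; apply: contraR.
    by move=> /pred0Pn[z /andP[/= zx zy]]; rewrite -(f_same _ _ zx) (f_same _ _ zy).
  - by apply/imsetP => -[x _ E]; have := f_refl x; rewrite -E inE.
by split=> // x; apply: (setpart_def_pblock Pp); rewrite ?imset_f.
Qed.

Lemma refinesP n (P Q : {set {set 'I_n}}) : P \in setpart n -> Q \in setpart n ->
  reflect (forall x, pblock P x \subset pblock Q x) (refines P Q).
Proof.
move=> Pp Qp; apply: (iffP forallP) => [H x|H C].
  have /implyP/(_ (setpart_pblock x Qp))/existsP[X /andP[/subsetP XP /eqP QX]] := H (pblock Q x).
  have := mem_setpart_pblock x Qp; rewrite QX => /bigcupP[B BX xB].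
  rewrite (setpart_def_pblock Pp (XP _ BX) xB); apply/subsetP => y yB.
  by apply/bigcupP; exists B.
apply/implyP => CQ; apply/existsP; exists [set B in P | B \subset C].
apply/andP; split; first by apply/subsetP => B; rewrite inE => /andP[].
apply/eqP/setP => x; apply/idP/bigcupP => [xC|[B]].
  exists (pblock P x); last exact: mem_setpart_pblock.
  by rewrite inE setpart_pblock //= -(setpart_def_pblock Qp CQ xC).
by rewrite inE => /andP[_ /subsetP]; apply.
Qed.

Lemma refines_refl n (P : {set {set 'I_n}}) : P \in setpart n -> refines P P.
Proof. by move=> Pp; apply/refinesP. Qed.

Lemma refines_trans n (P Q R : {set {set 'I_n}}) :
    P \in setpart n -> Q \in setpart n -> R \in setpart n ->
  refines P Q -> refines Q R -> refines P R.
Proof.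
move=> Pp Qp Rp /(refinesP Pp Qp) PQ /(refinesP Qp Rp) QR; apply/(refinesP Pp Rp) => x.
exact: subset_trans (PQ x) (QR x).
Qed.

(** Writing the rank as a sum over points lets it be compared point by point under refinement and
    carried between ground sets of different sizes. *)
Definition block_defect n (P : {set {set 'I_n}}) (x : 'I_n) : rat :=
  (1 - #|pblock P x|%:R^-1)%R.

Lemma card_pblock_gt0 n (P : {set {set 'I_n}}) x : P \in setpart n -> 0 < #|pblock P x|.
Proof. by move=> Pp; apply/card_gt0P; exists x; apply: mem_setpart_pblock. Qed.

Lemma block_defect_ge0 n (P : {set {set 'I_n}}) x : P \in setpart n -> (0 <= block_defect P x)%R.
Proof.
move=> Pp; rewrite subr_ge0 invf_le1 ?ler1n ?ltr0n ?card_pblock_gt0 //.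
Qed.

(* Each block B contributes |B| * (1 - 1/|B|) = |B| - 1 to the rank. *)
Lemma prank_sum n (P : {set {set 'I_n}}) : P \in setpart n ->
  ((prank P)%:R = \sum_x block_defect P x)%R.
Proof.
move=> Pp; have cardP : (\sum_x #|pblock P x|%:R^-1 = #|P|%:R :> rat)%R.
  rewrite (eq_bigl (fun x => x \in [set: 'I_n])) => [|x]; last by rewrite inE.
  have Pp' : partition P [set: 'I_n] by rewrite inE in Pp.
  rewrite (set_partition_big _ Pp') -sum1_card natr_sum; apply: eq_bigr => B BP.
  rewrite (eq_bigr (fun=> #|B|%:R^-1)%R) => [|x xB]; last first.
    by rewrite (setpart_def_pblock Pp BP xB).
  rewrite sumr_const -[LHS]mulr_natl mulfV // pnatr_eq0 -lt0n; rewrite card_gt0.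
  exact: partition_neq0 Pp' BP.
have sumE : (\sum_x block_defect P x = n%:R - #|P|%:R)%R.
  by rewrite sumrB sumr_const card_ord cardP.
(* The sum of the defects being non-negative also gives #|P| <= n, so the natural subtraction in
   [prank] is exact. *)
rewrite sumE /prank natrB // -(ler_nat rat) -subr_ge0 -sumE.
by apply: sumr_ge0 => x _; apply: block_defect_ge0.
Qed.

Lemma refines_defect n (P Q : {set {set 'I_n}}) x : P \in setpart n -> Q \in setpart n ->
  refines P Q -> (block_defect P x <= block_defect Q x)%R.
Proof.
move=> Pp Qp /(refinesP Pp Qp)/(_ x)/subset_leq_card le_c.
by rewrite lerD2l lerN2 lef_pV2 ?posrE ?ltr0n ?card_pblock_gt0 // ler_nat.
Qed.

Lemma refines_prank n (P Q : {set {set 'I_n}}) : P \in setpart n -> Q \in setpart n ->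
  refines P Q -> prank P <= prank Q.
Proof.
move=> Pp Qp PQ; rewrite -(ler_nat rat) !prank_sum //.
by apply: ler_sum => x _; apply: refines_defect.
Qed.

(** The defect at a point can only grow when passing from P to Q; with equal totals it is the same
    everywhere, and nested blocks of equal size coincide. *)
Lemma refines_eq_prank n (P Q : {set {set 'I_n}}) : P \in setpart n -> Q \in setpart n ->
  refines P Q -> prank Q <= prank P -> P = Q.
Proof.
move=> Pp Qp PQ leQP; apply: eq_setpart => // x; apply/eqP.
rewrite eqEcard; have /(refinesP Pp Qp) -> /= := PQ.
have sum0 : (\sum_x (block_defect Q x - block_defect P x) = 0)%R.
  rewrite sumrB -!prank_sum //; apply/eqP; rewrite subr_eq0 eqr_nat eqn_leq leQP.
  exact: refines_prank.
have ge0 y : true -> (0 <= block_defect Q y - block_defect P y)%R.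
  by move=> _; rewrite subr_ge0 refines_defect.
have /eqP := psumr_eq0P ge0 sum0 (isT : true) (i := x).
rewrite subr_eq0 /block_defect => /eqP/addrI/oppr_inj/invr_inj/eqP.
by rewrite eqr_nat => /eqP ->.
Qed.

Definition psupport n (P : {set {set 'I_n}}) : {set 'I_n} := [set x | pblock P x != [set x]].

(** A point of the support lies in a block of size at least 2, so its defect is at least 1/2. *)
Lemma card_support n (P : {set {set 'I_n}}) : P \in setpart n -> #|psupport P| <= 2 * prank P.
Proof.
move=> Pp; rewrite -(ler_nat rat) natrM prank_sum // mulr_sumr -sum1_card natr_sum.
rewrite [X in (_ <= X)%R](bigID (fun x => x \in psupport P)) /= -[X in (X <= _)%R]addr0.
apply: lerD; last first.
  by apply: sumr_ge0 => x _; rewrite mulr_ge0 ?block_defect_ge0.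
apply: ler_sum => x; rewrite inE => xs; have xx := mem_setpart_pblock x Pp.
have c2 : 1 < #|pblock P x|.
  rewrite ltn_neqAle card_pblock_gt0 // andbT eq_sym; apply: contra xs => /cards1P[y yE].
  by move: xx; rewrite yE inE => /eqP ->.
rewrite /block_defect mulrBr mulr1 lerBrDr -lerBrDl.
have : (#|pblock P x|%:R^-1 <= 2%:R^-1 :> rat)%R.
  by rewrite lef_pV2 ?posrE ?ltr0n // ?ler_nat //; apply: ltnW.
lra.
Qed.

Lemma support_refines n (P Q : {set {set 'I_n}}) : P \in setpart n -> Q \in setpart n ->
  refines P Q -> psupport P \subset psupport Q.
Proof.
move=> Pp Qp /(refinesP Pp Qp) PQ; apply/subsetP => x; rewrite !inE.
apply: contra => /eqP Q1; rewrite eqEsubset -{1}Q1 PQ sub1set.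
exact: mem_setpart_pblock.
Qed.

Lemma support_pblock n (P : {set {set 'I_n}}) (A : {set 'I_n}) x : P \in setpart n ->
  psupport P \subset A -> x \in A -> pblock P x \subset A.
Proof.
move=> Pp /subsetP sA xA; apply/subsetP => y yx; have [->//|neq] := eqVneq y x.
apply: sA; rewrite inE (setpart_same_pblock Pp yx); apply: contraNneq neq => E.
by have := mem_setpart_pblock x Pp; rewrite E inE eq_sym.
Qed.

Lemma pblock_out_support n (P : {set {set 'I_n}}) (A : {set 'I_n}) x :
  psupport P \subset A -> x \notin A -> pblock P x = [set x].
Proof.
by move=> /subsetP sA; apply: contraNeq => xs; apply: sA; rewrite inE.
Qed.

Lemma pact_setpart n (g : 'S_n) (P : {set {set 'I_n}}) : P \in setpart n ->
  pact g P \in setpart n /\ forall x, pblock (pact g P) (g x) = [set g y | y in pblock P x].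
Proof.
move=> Pp; pose f x := [set g y | y in pblock P (g^-1%g x)].
have fE : pact g P = [set f x | x : 'I_n].
  apply/setP => B; apply/imsetP/imsetP => [[C CP ->]|[x _ ->]].
    have /set0Pn[y yC] : C != set0 by apply: partition_neq0 CP; rewrite inE in Pp; apply: Pp.
    by exists (g y); rewrite // /f permK (setpart_def_pblock Pp CP yC).
  by exists (pblock P (g^-1%g x)); rewrite ?setpart_pblock.
have [] := @setpart_of_blocks n f.
- move=> x; apply/imsetP; exists (g^-1%g x); rewrite ?permKV //.
  exact: mem_setpart_pblock.
- move=> x y /imsetP[z zx ->]; rewrite /f permK.
  by rewrite (setpart_same_pblock Pp zx).
by rewrite -fE => gPp E; split=> // x; rewrite E /f permK.
Qed.

Lemma support_pact n (g : 'S_n) (P : {set {set 'I_n}}) : P \in setpart n ->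
  psupport (pact g P) = [set g x | x in psupport P].
Proof.
move=> Pp; have [_ E] := pact_setpart g Pp; apply/setP => y.
rewrite -[y](permKV g) (mem_imset _ _ (@perm_inj _ g)) !inE E.
by rewrite -imset_set1 (inj_eq (imset_inj (@perm_inj _ g))).
Qed.

End SetPartitions.

(** * Transport of chains *)

Section Transport.

Variables (n n' : nat) (A : {set 'I_n}) (A' : {set 'I_n'}).
Variables (phi : 'I_n -> 'I_n') (psi : 'I_n' -> 'I_n).
Hypotheses (phiA : {in A, forall x, phi x \in A'}) (psiA : {in A', forall y, psi y \in A}).
Hypotheses (phiK : {in A, cancel phi psi}) (psiK : {in A', cancel psi phi}).

(** The copy of P on [A'], completed by singletons outside [A']. Nothing is lost when the support of
    P lies in [A]. *)
Definition transport_block (P : {set {set 'I_n}}) (y : 'I_n') : {set 'I_n'} :=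
  if y \in A' then [set phi x | x in pblock P (psi y)] else [set y].

Definition transport (P : {set {set 'I_n}}) : {set {set 'I_n'}} :=
  [set transport_block P y | y : 'I_n'].

Let spart : {pred {set {set 'I_n}}} := [pred P | (P \in setpart n) && (psupport P \subset A)].

Lemma phi_inj : {in A &, injective phi}.
Proof. exact: can_in_inj phiK. Qed.

Lemma transportP P : P \in spart ->
  transport P \in setpart n' /\ pblock (transport P) =1 transport_block P.
Proof.
move=> /andP[Pp sA]; apply: setpart_of_blocks => [y|y z]; rewrite /transport_block.
  case: ifP => yA; last by rewrite inE.
  by rewrite -{1}(psiK yA) imset_f ?mem_setpart_pblock.
case: ifP => yA; last by rewrite inE => /eqP ->; rewrite yA.
move=> /imsetP[x xy ->]; have xA : x \in A.
  by apply: (subsetP (support_pblock Pp sA (psiA yA))).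
by rewrite phiA // phiK // (setpart_same_pblock Pp xy).
Qed.

Lemma transport_pblock P x : P \in spart -> x \in A ->
  pblock (transport P) (phi x) = [set phi y | y in pblock P x].
Proof.
by move=> Ps xA; have [_ ->] := transportP Ps; rewrite /transport_block phiA // phiK.
Qed.

Lemma transport_out P y : P \in spart -> y \notin A' -> pblock (transport P) y = [set y].
Proof. by move=> Ps yA; have [_ ->] := transportP Ps; rewrite /transport_block (negPf yA). Qed.

Lemma card_transport_pblock P x : P \in spart -> x \in A ->
  #|pblock (transport P) (phi x)| = #|pblock P x|.
Proof.
move=> Ps xA; rewrite transport_pblock //; apply: card_in_imset.
have /andP[Pp sA] := Ps; move=> y z yx zx; apply: phi_inj.
  exact: (subsetP (support_pblock Pp sA xA)).
exact: (subsetP (support_pblock Pp sA xA)).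
Qed.

(** Points outside [A] and [A'] are singletons, of defect 0, and block sizes inside are preserved;
    hence the rank does not see the difference between n and n'. *)
Lemma prank_transport P : P \in spart -> prank (transport P) = prank P.
Proof.
move=> Ps; have /andP[Pp sA] := Ps; have [tPp _] := transportP Ps.
apply/eqP; rewrite -(eqr_nat rat) !prank_sum //; apply/eqP.
rewrite (bigID (fun y => y \in A')) /= [X in (_ + X)%R]big1 ?addr0; last first.
  by move=> y yA; rewrite /block_defect transport_out // cards1 invr1 subrr.
rewrite [RHS](bigID (fun x => x \in A)) /= [X in (_ = _ + X)%R]big1 ?addr0; last first.
  by move=> x xA; rewrite /block_defect (pblock_out_support sA xA) cards1 invr1 subrr.
rewrite (reindex_onto phi psi) => [|y yA]; last exact: psiK.
apply: eq_big => [x|x /andP[xA' /eqP E]].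
  apply/andP/idP => [[xA' /eqP <-]|xA]; first exact: psiA.
  by rewrite phiA // phiK.
by rewrite /block_defect card_transport_pblock // -E psiA.
Qed.

Lemma support_transport P : P \in spart -> psupport (transport P) = [set phi x | x in psupport P].
Proof.
move=> Ps; have /andP[Pp sA] := Ps; apply/setP => y; rewrite inE.
apply/idP/imsetP => [ys|[x xs ->]].
  have yA : y \in A'.
    by apply: contraR ys => yA; rewrite transport_out.
  exists (psi y); last by rewrite psiK.
  rewrite inE; apply: contra ys => /eqP E.
  by rewrite -{1}(psiK yA) transport_pblock ?psiA // E imset_set1 psiK.
have xA : x \in A by apply: (subsetP sA).
move: xs; rewrite inE; apply: contra => /eqP E.
have /cards1P[z zE] : #|pblock P x| == 1 by rewrite -card_transport_pblock // E cards1.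
by have := mem_setpart_pblock x Pp; rewrite zE inE => /eqP ->.
Qed.

Lemma refines_transport P Q : P \in spart -> Q \in spart -> refines P Q ->
  refines (transport P) (transport Q).
Proof.
move=> Ps Qs; have /andP[Pp _] := Ps; have /andP[Qp _] := Qs => /(refinesP Pp Qp) PQ.
have [tPp EP] := transportP Ps; have [tQp EQ] := transportP Qs.
apply/(refinesP tPp tQp) => y; rewrite EP EQ /transport_block.
by case: ifP => // _; apply: imsetS.
Qed.

Lemma transport_inj : {in spart &, injective transport}.
Proof.
move=> P Q Ps Qs E; have /andP[Pp sP] := Ps; have /andP[Qp sQ] := Qs.
apply: eq_setpart => // x; have [xA|xA] := boolP (x \in A); last first.
  by rewrite (pblock_out_support sP xA) (pblock_out_support sQ xA).
have back (B : {set 'I_n}) : B \subset A -> [set psi y | y in [set phi x | x in B]] = B.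
  move=> /subsetP sB; rewrite -imset_comp -[RHS]imset_id; apply: eq_in_imset => z zB /=.
  by rewrite phiK ?sB.
rewrite -(back _ (support_pblock Pp sP xA)) -(back _ (support_pblock Qp sQ xA)).
by rewrite -!transport_pblock // E.
Qed.

Lemma transport_pact (g : 'S_n) (g' : 'S_n') P :
    stable g A -> stable g' A' -> {in A, forall x, phi (g x) = g' (phi x)} ->
    P \in spart ->
  pact g P \in spart /\ transport (pact g P) = pact g' (transport P).
Proof.
move=> /stableP gA /stableP gA' equiv Ps; have /andP[Pp sA] := Ps.
have [gPp gE] := pact_setpart g Pp.
have gPs : pact g P \in spart.
  rewrite inE gPp support_pact //=; apply/subsetP => _ /imsetP[x xs ->].
  by rewrite gA (subsetP sA).
split=> //; have [tPp _] := transportP Ps; have [tgPp _] := transportP gPs.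
have [gtPp gtE] := pact_setpart g' tPp.
apply: eq_setpart => // y'; rewrite -[y'](permKV g'); set y := (g'^-1)%g y'.
rewrite gtE; have [yA|yA] := boolP (y \in A'); last first.
  by rewrite transport_out ?gA' // transport_out // imset_set1.
rewrite -(psiK yA) -equiv ?psiA // !transport_pblock ?gA ?psiA //.
rewrite gE -!imset_comp; apply: eq_in_imset => z zy /=.
by rewrite equiv //; apply: (subsetP (support_pblock Pp sA (psiA yA))).
Qed.

End Transport.

(** * Chains with prescribed ranks and support *)

Section Chains.

(** The maximal chains of the rank-selected poset ([max_chainE]), with ranks given as natural
    numbers so that the notion is uniform in n. *)
Definition rank_chain n (T : seq nat) (C : {set {set {set 'I_n}}}) :=
  [&& C \subset setpart n, is_chain C, [forall P in C, prank P \in T] &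
      all (fun t => [exists P in C, prank P == t]) T].

Definition chain_support n (C : {set {set {set 'I_n}}}) : {set 'I_n} :=
  \bigcup_(P in C) psupport P.

(** When [A] is all of ['I_k], this is the value at [g] of the character F_k for the rank set
    [T]. *)
Definition fixed_chains n (T : seq nat) (g : 'S_n) (A : {set 'I_n}) : nat :=
  #|[set C | [&& rank_chain T C, chain_act g C == C & chain_support C == A]]|.

Lemma is_chainP n (C : {set {set {set 'I_n}}}) :
  reflect {in C &, forall P Q, refines P Q || refines Q P} (is_chain C).
Proof.
apply: (iffP forallP) => [H P Q PC QC|H P].
  by have /implyP/(_ PC)/forallP/(_ Q)/implyP/(_ QC) := H P.
by apply/implyP => PC; apply/forallP => Q; apply/implyP => QC; apply: H.
Qed.

(** Transport along the equivariant bijection [phi] is injective on the chains counted. The reverse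
    inequality comes from exchanging the two sides. *)
Lemma fixed_chains_le n n' T (A : {set 'I_n}) (A' : {set 'I_n'}) phi psi (g : 'S_n) (g' : 'S_n') :
    {in A, forall x, phi x \in A'} -> {in A', forall y, psi y \in A} ->
    {in A, cancel phi psi} -> {in A', cancel psi phi} ->
    stable g A -> stable g' A' -> {in A, forall x, phi (g x) = g' (phi x)} ->
  fixed_chains T g A <= fixed_chains T g' A'.
Proof.
move=> phiA psiA phiK psiK gA gA' equiv; pose tr := transport A' phi psi.
pose good C := [&& rank_chain T C, chain_act g C == C & chain_support C == A].
have good_spart (C : {set {set {set 'I_n}}}) P : good C -> P \in C ->
    (P \in setpart n) && (psupport P \subset A).
  move=> /and3P[/and4P[/subsetP Cp _ _ _] _ /eqP <-] PC; rewrite Cp //=.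
  exact: bigcup_sup.
pose h (C : {set {set {set 'I_n}}}) : {set {set {set 'I_n'}}} := [set tr P | P in C].
apply: (@leq_card_in_inj _ _ h) => [C D|C].
  rewrite !inE => Cg Dg /setP E.
  have sub (C1 C2 : {set {set {set 'I_n}}}) : good C1 -> good C2 ->
      [set tr P | P in C1] =i [set tr P | P in C2] -> C1 \subset C2.
    move=> g1 g2 eq; apply/subsetP => P PC; have := imset_f tr PC; rewrite eq.
    move=> /imsetP[Q QC /(transport_inj phiA psiA phiK psiK)] -> //.
      exact: good_spart g1 _.
    exact: good_spart g2 _.
  by apply/eqP; rewrite eqEsubset !sub // => x; rewrite E.
rewrite !inE -/(good C) => Cg; have sp := good_spart C _ Cg.
have /and3P[/and4P[/subsetP Cp /is_chainP Cch /forallP Crk Cex] /eqP Cfix /eqP Csupp] := Cg.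
apply/and3P; split; [apply/and4P; split | |].
- apply/subsetP => _ /imsetP[P PC ->].
  by have [] := transportP phiA psiA phiK psiK (sp P PC).
- apply/is_chainP => _ _ /imsetP[P PC ->] /imsetP[Q QC ->].
  have trR := refines_transport phiA psiA phiK psiK.
  case/orP: (Cch P Q PC QC) => H; apply/orP.
    by left; apply: trR H; apply: sp.
  by right; apply: trR H; apply: sp.
- apply/forallP => P'; apply/implyP => /imsetP[P PC ->].
  rewrite (prank_transport phiA psiA phiK psiK); first exact: (implyP (Crk P)).
  exact: sp.
- apply/allP => t /(allP Cex) /existsP[P /andP[PC rP]]; apply/existsP; exists (tr P).
  by rewrite imset_f // (prank_transport phiA psiA phiK psiK) //; apply: sp.
- rewrite -{2}Cfix /chain_act /h -!imset_comp; apply/eqP/eq_in_imset => P PC /=.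
  by have [] := transport_pact phiA psiA phiK psiK gA gA' equiv (sp P PC).
apply/eqP/setP => y; apply/bigcupP/idP => [[_ /imsetP[P PC ->]]|yA].
  rewrite (support_transport phiA psiA phiK psiK) => [/imsetP[x xs ->]|]; last exact: sp.
  by apply: phiA; case/andP: (sp P PC) => _ /subsetP; apply.
have := psiA _ yA; rewrite -Csupp => /bigcupP[P PC ys]; exists (tr P); first exact: imset_f.
rewrite (support_transport phiA psiA phiK psiK); last exact: sp.
by apply/imsetP; exists (psi y); rewrite ?psiK.
Qed.

End Chains.

(** * Equal cycle lengths give equally many fixed chains *)

Section Conjugation.

Lemma iter_mod_porbit n (g : 'S_n) x k :
  iter k g x = iter (k %% #|porbit g x|) g x.
Proof.
rewrite {1}(divn_eq k #|porbit g x|) addnC iterD; congr (iter _ _ _).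
by elim: (k %/ _) => //= q IH; rewrite mulSn iterD IH iter_porbit.
Qed.

Lemma iter_inj_porbit n (g : 'S_n) x k l : k < #|porbit g x| -> l < #|porbit g x| ->
  iter k g x = iter l g x -> k = l.
Proof.
move=> km lm; rewrite -(nth_traject g km) -(nth_traject g lm) => /eqP.
by rewrite nth_uniq ?size_traject ?uniq_traject_porbit // => /eqP.
Qed.

Lemma stable_iter n (g : 'S_n) (A : {set 'I_n}) x k : stable g A ->
  (iter k g x \in A) = (x \in A).
Proof. by move=> /stableP gA; elim: k => //= k IH; rewrite gA. Qed.

Lemma porbit_iter n (g : 'S_n) x k : porbit g (iter k g x) = porbit g x.
Proof. by elim: k => //= k IH; rewrite porbit_step. Qed.

Lemma porbit_iterP n (g : 'S_n) x y : y \in porbit g x ->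
  exists2 k, k < #|porbit g x| & y = iter k g x.
Proof. by rewrite porbit_traject => /trajectP[k lk ->]; exists k. Qed.

(** Cycles of equal length are matched by the index permutation [Is]; in each matched pair base
    points are chosen, and the k-th iterate of one is sent to the k-th iterate of the other. [x0]
    and [y0] are defaults for the choice of base points. *)
Lemma conj_embedding n n' (g : 'S_n) (g' : 'S_n') (A : {set 'I_n}) (A' : {set 'I_n'})
    (x0 : 'I_n) (y0 : 'I_n') :
    stable g A -> stable g' A' -> perm_eq (lens_in g A) (lens_in g' A') ->
  exists phi : 'I_n -> 'I_n',
    [/\ {in A, forall x, phi x \in A'}, {in A &, injective phi} &
        {in A, forall x, phi (g x) = g' (phi x)}].
Proof.
move=> gA gA' pE; have [Is IsP lensE] := perm_iotaP 0 pE.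
set O := orbits_in g A; set O' := orbits_in g' A'.
have szO : size (lens_in g A) = size O by rewrite size_map.
have szO' : size (lens_in g' A') = size O' by rewrite size_map.
have szI : size Is = size O by rewrite -szO lensE size_map.
have IsO i : i < size O -> nth 0 Is i < size O'.
  move=> iO; have : nth 0 Is i \in Is by rewrite mem_nth ?szI.
  by rewrite (perm_mem IsP) mem_iota add0n szO'.
pose rep m (d : 'I_m) (c : {set 'I_m}) := odflt d [pick y in c].
have repP m d (c : {set 'I_m}) x : x \in c -> rep m d c \in c.
  by move=> xc; rewrite /rep; case: pickP => //= /(_ x); rewrite xc.
pose base x := rep n x0 (porbit g x).
pose base' x := rep n' y0 (nth set0 O' (nth 0 Is (index (porbit g x) O))).
(* The position of x in [traject] is the number of steps from the base point to x. *)
pose phi x := iter (index x (traject g (base x) #|porbit g x|)) g' (base' x).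
have porbit_base x : porbit g (base x) = porbit g x.
  by apply/eqP; rewrite eq_porbit_mem; apply: repP (porbit_id _ _).
have idxP x : x \in A -> index (porbit g x) O < size O.
  by move=> xA; rewrite index_mem mem_orbits_in.
have blk'P x : x \in A -> nth set0 O' (nth 0 Is (index (porbit g x) O)) = porbit g' (base' x)
    /\ base' x \in A'.
  move=> /idxP/IsO lt'; have := mem_nth set0 lt'; set c := nth set0 _ _ => cO.
  have [y yA cE] := orbits_inP cO.
  have yc : y \in c by rewrite cE porbit_id.
  have bc : base' x \in c := repP _ _ _ _ yc.
  have cE' : c = porbit g' (base' x).
    by rewrite cE; apply/esym/eqP; rewrite eq_porbit_mem -cE.
  by split=> //; rewrite -(mem_orbits_in _ gA') -cE'.
have card' x : x \in A -> #|porbit g' (base' x)| = #|porbit g x|.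
  move=> xA; have [<- _] := blk'P x xA; have lt := idxP x xA.
  rewrite -(nth_map set0 0 (fun c : {set 'I_n'} => #|c|)) ?IsO //.
  rewrite -(nth_map 0 0 (nth 0 (lens_in g' A'))) ?szI // -lensE.
  by rewrite (nth_map set0) // nth_index // mem_orbits_in.
have phiE x k : x \in A -> phi (iter k g (base x)) = iter k g' (base' x).
  move=> xA; have bE : base (iter k g (base x)) = base x.
    by rewrite /base porbit_iter porbit_base.
  have bE' : base' (iter k g (base x)) = base' x.
    by rewrite /base' porbit_iter porbit_base.
  rewrite /phi bE bE' porbit_iter porbit_base [RHS]iter_mod_porbit card' //.
  congr (iter _ _ _); rewrite iter_mod_porbit porbit_base.
  have lt : k %% #|porbit g x| < #|porbit g x| by rewrite ltn_mod card_gt0 -cards_eq0 card_porbit_neq0.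
  rewrite -(nth_traject g lt) index_uniq ?size_traject //.
  by rewrite -porbit_base uniq_traject_porbit.
have iterE x : exists2 k, k < #|porbit g x| & x = iter k g (base x).
  have : x \in porbit g (base x) by rewrite porbit_base porbit_id.
  by move=> /porbit_iterP; rewrite porbit_base.
exists phi; split.
- move=> x xA; have [k _ xE] := iterE x; rewrite {1}xE phiE // stable_iter //.
  by have [] := blk'P x xA.
- move=> x y xA yA; have [k kx xE] := iterE x; have [l ly yE] := iterE y.
  rewrite {1}xE {1}yE !phiE // => eq.
  have /eqP eqO : porbit g' (base' x) = porbit g' (base' y).
    by rewrite -(porbit_iter g' _ k) eq porbit_iter.
  move: eqO; have [<- _] := blk'P x xA; have [<- _] := blk'P y yA.
  rewrite nth_uniq ?IsO ?idxP ?orbits_in_uniq // nth_uniq ?szI ?idxP //; last first.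
    by rewrite (perm_uniq IsP) iota_uniq.
  move=> /eqP/(congr1 (nth set0 O)); rewrite !nth_index ?mem_orbits_in // => pxy.
  have bxy : base x = base y by rewrite /base pxy.
  have bxy' : base' x = base' y by rewrite /base' pxy.
  rewrite xE yE bxy; congr (iter _ _ _); apply: (@iter_inj_porbit _ g' (base' x)).
  + by rewrite card'.
  + by rewrite card' // pxy.
  by rewrite eq bxy'.
- move=> x xA; have [k _ xE] := iterE x.
  by rewrite {1 2}xE -iterS !phiE.
Qed.

Lemma fixed_chains_eq n n' T (g : 'S_n) (g' : 'S_n') (A : {set 'I_n}) (A' : {set 'I_n'})
    (x0 : 'I_n) (y0 : 'I_n') :
    stable g A -> stable g' A' -> perm_eq (lens_in g A) (lens_in g' A') ->
  fixed_chains T g A = fixed_chains T g' A'.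
Proof.
suff H m m' (h : 'S_m) (h' : 'S_m') (B : {set 'I_m}) (B' : {set 'I_m'}) (x : 'I_m) (y : 'I_m') :
    stable h B -> stable h' B' -> perm_eq (lens_in h B) (lens_in h' B') ->
    fixed_chains T h B <= fixed_chains T h' B'.
  move=> gA gA' pE; apply/eqP; rewrite eqn_leq; apply/andP; split; first exact: H.
  by apply: H => //; rewrite perm_sym.
move=> hB hB' pE; have [phi [phiB phi_inj equiv]] := conj_embedding x y hB hB' pE.
have [phi' [phiB' phi_inj' _]] : exists phi' : 'I_m' -> 'I_m,
    [/\ {in B', forall z, phi' z \in B}, {in B' &, injective phi'} &
        {in B', forall z, phi' (h' z) = h (phi' z)}].
  by apply: conj_embedding => //; rewrite perm_sym.
(* The embedding in the other direction gives |B'| <= |B|, so [phi] is onto [B']. *)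
have imE : [set phi z | z in B] = B'.
  apply/eqP; rewrite eqEcard card_in_imset // (leq_card_in_inj phi_inj' phiB') andbT.
  by apply/subsetP => _ /imsetP[z zB ->]; apply: phiB.
pose psi z := odflt x [pick w in B | phi w == z].
have psiP z : z \in B' -> psi z \in B /\ phi (psi z) = z.
  rewrite -imE => /imsetP[w wB ->]; rewrite /psi; case: pickP => [u /andP[uB /eqP //]|/(_ w)].
  by rewrite wB eqxx.
apply: (@fixed_chains_le _ _ _ _ _ phi psi) => //.
- by move=> z /psiP[].
- by move=> z zB; have [? ?] := psiP _ (phiB _ zB); apply: phi_inj.
- by move=> z /psiP[].
Qed.

(** Empty support forces rank 0, which [T] excludes, so only the empty chain remains. This settles
    the case in which the default points for [fixed_chains_eq] may not exist. *)
Lemma fixed_chains0 n T (g : 'S_n) : 0 \notin T -> fixed_chains T g set0 = (T == [::]).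
Proof.
move=> T0; have empty (C : {set {set {set 'I_n}}}) :
    rank_chain T C -> chain_support C = set0 -> C = set0.
  move=> /and4P[/subsetP Cp _ /forallP Crk _] sC; apply/setP => P; rewrite inE; apply/negP => PC.
  have := implyP (Crk P) PC; suff -> : prank P = 0 by rewrite (negPf T0).
  apply/eqP; rewrite -(eqr_nat rat) prank_sum ?Cp // big1 // => x _.
  rewrite /block_defect (@pblock_out_support _ _ set0) ?inE ?cards1 ?invr1 ?subrr //.
  by rewrite -sC; apply: bigcup_sup PC.
case: T T0 empty => [|t T] T0 empty /=.
  rewrite /fixed_chains (eq_card1 (x := set0)) // => C; rewrite !inE.
  apply/and3P/eqP => [[rC _ /eqP sC]|->]; first exact: empty.
  split; last by rewrite /chain_support big_set0.
    apply/and4P; split; rewrite ?sub0set //.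
      by apply/is_chainP => P Q; rewrite inE.
    by apply/forallP => P; rewrite inE.
  by rewrite /chain_act imset0.
apply/eqP; rewrite cards_eq0; apply/eqP/setP => C; rewrite !inE; apply/negP => /and3P[rC _ /eqP sC].
have C0 := empty C rC sC; case/and4P: rC => _ _ _ /= /andP[/existsP[P]].
by rewrite C0 inE.
Qed.

Lemma sumn_lens_in n (g : 'S_n) (A : {set 'I_n}) : stable g A -> sumn (lens_in g A) = #|A|.
Proof.
move=> gA; rewrite sumnE big_map big_filter big_enum_cond /= -[RHS]sum1_card.
rewrite [RHS](partition_big (porbit g) (fun c => (c \in porbits g) && (c \subset A))) => [|x xA]; last first.
  by rewrite stable_porbit // andbT; apply: imset_f.
apply: eq_bigr => c /andP[/imsetP[y _ ->] /subsetP sub]; rewrite -sum1_card.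
apply: eq_bigl => x; rewrite -eq_porbit_mem [RHS]andbC; case: eqP => //= pxy.
by apply/esym/sub; rewrite -pxy porbit_id.
Qed.

End Conjugation.

(** * Maximal chains of rank-selected subposets *)

Section MaximalChains.

Lemma discrete_setpart n : exists2 P : {set {set 'I_n}}, P \in setpart n &
  pblock P =1 (fun x => [set x]).
Proof.
have [] := @setpart_of_blocks n (fun x => [set x]).
- by move=> x; rewrite inE.
- by move=> x y; rewrite inE => /eqP ->.
by move=> Pp PE; exists [set [set x] | x : 'I_n].
Qed.

(** Two blocks of R that lie in a common block of Q are united. *)
Lemma merge_setpart n (R Q : {set {set 'I_n}}) : R \in setpart n -> Q \in setpart n ->
    refines R Q -> R != Q ->
  exists R' : {set {set 'I_n}}, [/\ R' \in setpart n, refines R R', refines R' Q &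
    prank R < prank R' <= (prank R).+1].
Proof.
move=> Rp Qp RQ neq; have /(refinesP Rp Qp) sub := RQ.
have /forallPn[x /subsetPn[y yQ yR]] : ~~ [forall x, pblock Q x \subset pblock R x].
  apply: contra neq => /forallP H; apply/eqP/eq_setpart => // x.
  by apply/eqP; rewrite eqEsubset sub H.
set X := pblock R x; set Y := pblock R y.
have xX : x \in X by apply: mem_setpart_pblock.
have yY : y \in Y by apply: mem_setpart_pblock.
pose f z := if z \in X :|: Y then X :|: Y else pblock R z.
have [] := @setpart_of_blocks n f.
- by move=> z; rewrite /f; case: ifP => // _; apply: mem_setpart_pblock.
- move=> z w; rewrite /f; case: ifP => [_ -> //|zXY wz]; case: ifP => [wXY|_].
    have : z \in pblock R w by rewrite (setpart_same_pblock Rp wz) mem_setpart_pblock.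
    by case/setUP: wXY => wB; rewrite (setpart_same_pblock Rp wB) => zB;
       rewrite inE zB ?orbT in zXY.
  exact: setpart_same_pblock.
set R' := [set _ | _ in _] => R'p R'E; exists R'.
have RR' : refines R R'.
  apply/(refinesP Rp R'p) => z; rewrite R'E /f; case: ifP => // /setUP[] zB.
    by rewrite (setpart_same_pblock Rp zB) subsetUl.
  by rewrite (setpart_same_pblock Rp zB) subsetUr.
split=> //.
  apply/(refinesP R'p Qp) => z; rewrite R'E /f; case: ifP => // zXY.
  have zQ : pblock Q z = pblock Q x.
    case/setUP: zXY => zB; first exact: (setpart_same_pblock Qp (subsetP (sub x) _ zB)).
    rewrite (setpart_same_pblock Qp (subsetP (sub y) _ zB)).
    exact: setpart_same_pblock.
  by rewrite zQ subUset sub /= -(setpart_same_pblock Qp yQ) sub.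
apply/andP; split.
  rewrite ltnNge; apply/negP => le; have RE := refines_eq_prank Rp R'p RR' le.
  have := R'E x; rewrite -RE /f inE xX /= -/X => XE.
  by move: yR; rewrite -/X XE inE yY orbT.
(* Blocks of R other than X and Y survive in R' and differ from the merged block, so R has at most
   one block more than R'. *)
have subR : R \subset X |: (Y |: (R' :\ (X :|: Y))).
  apply/subsetP => B BR; rewrite !inE; have [//|BX] := eqVneq B X.
  have [//|BY] /= := eqVneq B Y; have /set0Pn[z zB] : B != set0.
    by apply: partition_neq0 BR; rewrite inE in Rp; apply: Rp.
  have BE := setpart_def_pblock Rp BR zB.
  have zXY : z \notin X :|: Y.
    rewrite inE negb_or; apply/andP; split.
      by apply: contra BX => zX; rewrite -BE (setpart_same_pblock Rp zX).
    by apply: contra BY => zY; rewrite -BE (setpart_same_pblock Rp zY).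
  rewrite -{2}BE; have -> : pblock R z = pblock R' z by rewrite R'E /f (negPf zXY).
  rewrite setpart_pblock // andbT; apply: contraNneq zXY => <-.
  by rewrite zB.
have XYR : X :|: Y \in R'.
  by have := setpart_pblock x R'p; rewrite R'E /f inE xX.
have cardU1 (B : {set 'I_n}) (D : {set {set 'I_n}}) : #|B |: D| <= #|D|.+1.
  by rewrite cardsU1 -[_.+1]add1n leq_add2r leq_b1.
have := leq_trans (leq_trans (subset_leq_card subR) (cardU1 _ _)) (cardU1 _ _ : _.+1 <= _.+2).
have := cardsD1 (X :|: Y) R'; rewrite XYR /prank.
by move: #|R'| #|R| #|_ :\ _| => a b c; lia.
Qed.

(** Among the partitions of rank at most t that lie above the chain members of rank at most t and
    below the others, one of largest rank is taken; were its rank less than t, merging two blocks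
    would give a larger one. *)
Lemma insert_rank n (C : {set {set {set 'I_n}}}) t : C \subset setpart n -> is_chain C -> t < n ->
  exists R : {set {set 'I_n}}, [/\ R \in setpart n, prank R = t &
    {in C, forall P, refines P R || refines R P}].
Proof.
move=> /subsetP Cp /is_chainP Cch ltn.
have cmp P Q : P \in C -> Q \in C -> prank P <= prank Q -> refines P Q.
  move=> PC QC le; case/orP: (Cch P Q PC QC) => // QP.
  by rewrite -(refines_eq_prank (Cp _ QC) (Cp _ PC) QP le) refines_refl // Cp.
pose S := [set R in setpart n | [&& prank R <= t,
   [forall P in C, (prank P <= t) ==> refines P R] &
   [forall P in C, (t < prank P) ==> refines R P]]].
have [R0 R0S] : exists R0, R0 \in S.
  (* A starting element: the highest chain member of rank at most t, or the discrete partition if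
     there is none. *)
  have [|noL] := boolP [exists P in C, prank P <= t].
    move=> /existsP[P1 P1C].
    have [M /andP[MC Mt] Mmax] := @arg_maxnP _ P1 (fun P => (P \in C) && (prank P <= t)) (@prank n) P1C.
    exists M; rewrite inE Cp //= Mt /=; apply/andP; split.
      apply/forallP => P; apply/implyP => PC; apply/implyP => Pt.
      by apply: cmp => //; apply: Mmax; rewrite PC.
    apply/forallP => P; apply/implyP => PC; apply/implyP => Pt.
    by apply: cmp => //; apply: ltnW; apply: leq_ltn_trans Pt.
  have [D Dp DE] := discrete_setpart n; exists D; rewrite inE Dp /=.
  have -> : prank D = 0.
    apply/eqP; rewrite -(eqr_nat rat) prank_sum // big1 // => x _.
    by rewrite /block_defect DE cards1 invr1 subrr.
  rewrite leq0n /=; apply/andP; split.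
    apply/forallP => P; apply/implyP => PC; apply/implyP => Pt.
    by move: noL => /existsPn/(_ P); rewrite PC Pt.
  apply/forallP => P; apply/implyP => PC; apply/implyP => _.
  apply/(refinesP Dp (Cp _ PC)) => x; rewrite DE sub1set.
  by apply: mem_setpart_pblock; apply: Cp.
have [R RS Rmax] := @arg_maxnP _ R0 (fun R => R \in S) (@prank n) R0S.
move: RS; rewrite inE => /andP[Rp /and3P[Rt /forallP RL /forallP RH]].
exists R; split=> //; last first.
  move=> P PC; case: (leqP (prank P) t) => Pt; apply/orP; [left|right].
    by have /implyP/(_ PC)/implyP := RL P; apply.
  by have /implyP/(_ PC)/implyP := RH P; apply.
apply/eqP; rewrite eqn_leq Rt leqNgt; apply/negP => ltR.
(* The target of the merging: the lowest chain member of rank above t, or else the one-block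
   partition, whose rank n - 1 exceeds that of R because t < n. *)
have [Q [Qp RQ ltQ QH]] : exists Q : {set {set 'I_n}}, [/\ Q \in setpart n, refines R Q,
    prank R < prank Q & {in C, forall P, t < prank P -> refines Q P}].
  have [|noH] := boolP [exists P in C, t < prank P].
    move=> /existsP[P1 P1C].
    have [M /andP[MC Mt] Mmin] := @arg_minnP _ P1 (fun P => (P \in C) && (t < prank P)) (@prank n) P1C.
    exists M; split; first exact: Cp.
    - by have /implyP/(_ MC)/implyP := RH M; apply.
    - exact: ltn_trans ltR Mt.
    by move=> P PC Pt; apply: cmp => //; apply: Mmin; rewrite PC.
  have [] := @setpart_of_blocks n (fun=> setT); [by move=> x; rewrite inE | by [] |].
  set Q := [set _ | _ in _] => Qp QE; exists Q; split=> //.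
  - by apply/(refinesP Rp Qp) => x; rewrite QE subsetT.
  - suff : #|Q| <= 1.
      rewrite [X in _ < X]/prank; move: #|Q| (prank R) ltR => q r; lia.
    rewrite -(cards1 [set: 'I_n]); apply: subset_leq_card.
    by apply/subsetP => _ /imsetP[x _ ->]; rewrite inE.
  by move=> P PC Pt; move: noH => /existsPn/(_ P); rewrite PC Pt.
have neq : R != Q by apply: contraTneq ltQ => ->; rewrite ltnn.
have [R' [R'p RR' R'Q /andP[lt1 lt2]]] := merge_setpart Rp Qp RQ neq.
have /Rmax : R' \in S; last by rewrite /= leqNgt lt1.
rewrite inE R'p (leq_trans lt2 ltR) /=; apply/andP; split.
  apply/forallP => P; apply/implyP => PC; apply/implyP => Pt.
  apply: refines_trans RR' => //; first exact: Cp.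
  by have /implyP/(_ PC)/implyP := RL P; apply.
apply/forallP => P; apply/implyP => PC; apply/implyP => Pt.
by apply: refines_trans R'Q _ => //; [exact: Cp | exact: QH].
Qed.

(** A rank missing from a maximal chain could be filled by [insert_rank]. Conversely, when every
    rank occurs nothing can be added, since comparable partitions of the same rank are equal. *)
Lemma max_chainE n (Tn : {set 'I_n}) T (C : {set {set {set 'I_n}}}) :
    (forall t, (t \in T) = [exists s in Tn, val s == t]) ->
  max_chain Tn C = rank_chain T C.
Proof.
move=> TE; have rsE P : (P \in rank_sel Tn) = (P \in setpart n) && (prank P \in T).
  by rewrite inE TE.
apply/and3P/and4P => [[/subsetP Crs Cch /forallP Cmax]|[/subsetP Cp Cch /forallP Crk /allP Cex]].
  have Cp : C \subset setpart n by apply/subsetP => P /Crs; rewrite rsE => /andP[].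
  split=> //.
    by apply/forallP => P; apply/implyP => /Crs; rewrite rsE => /andP[].
  apply/allP => t tT; have := tT; rewrite TE => /existsP[s /andP[_ /eqP st]].
  have [|R [Rp Rt Rcmp]] := @insert_rank n C t Cp Cch; first by rewrite -st; apply: ltn_ord.
  apply/existsP; exists R; rewrite Rt eqxx andbT.
  suff RC : R |: C = C by rewrite -RC !inE eqxx.
  apply/eqP; apply: (implyP (Cmax (R |: C))).
  apply/and3P; split; last exact: subsetUr.
    apply/is_chainP => P Q /setU1P[->|PC] /setU1P[->|QC].
    - by rewrite refines_refl.
    - by rewrite orbC Rcmp.
    - exact: Rcmp.
    - exact: (is_chainP _ Cch).
  apply/subsetP => P /setU1P[->|/Crs //]; by rewrite rsE Rp Rt.
split=> //.
  by apply/subsetP => P PC; rewrite rsE Cp //=; apply: (implyP (Crk P)).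
apply/forallP => D; apply/implyP => /and3P[/is_chainP Dch /subsetP Drs sub].
rewrite eq_sym eqEsubset sub /=; apply/subsetP => P PD.
have := Drs P PD; rewrite rsE => /andP[Pp /Cex/existsP[Q /andP[QC /eqP Qr]]].
have QD := subsetP sub Q QC; have Qp := Cp Q QC.
case/orP: (Dch P Q PD QD) => H; last first.
  by rewrite -(refines_eq_prank Qp Pp H) // Qr.
by rewrite (refines_eq_prank Pp Qp H) // Qr.
Qed.

End MaximalChains.

(** * Expansion of beta *)

Section Expansion.
Local Open Scope ring_scope.

Definition cons_ffun l (p : nat) (b : {ffun 'I_l -> int}) : {ffun 'I_l.+1 -> int} :=
  [ffun j => if unlift ord0 j is Some i then b i else Posz p].

(** The points not of colour 0 form a [g]-stable set of size k, coloured by the remaining colours.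
    This is the formula for a character induced from S_k x S_(n-k), trivial on the second factor. *)
Lemma pcoef_cons n (g : 'S_n) k l (b : {ffun 'I_l -> int}) : (k <= n)%N ->
  pcoef (cyc_lens g) (cons_ffun (n - k) b) =
  (\sum_(A : {set 'I_n} | stable g A && (#|A| == k)) pcoef (lens_in g A) b)%N.
Proof.
move=> kn; rewrite pcoef_colourT -sum1_card.
pose supp (e : {ffun 'I_n -> 'I_l.+1}) := [set x | e x != ord0].
rewrite (partition_big supp (fun A => stable g A && (#|A| == k))) => [|e]; last first.
  rewrite inE => /andP[/forallP einv /forallP/(_ ord0)].
  rewrite ffunE unlift_none eqz_nat => /eqP c0; apply/andP; split.
    by apply/stableP => x; rewrite !inE (eqP (einv x)).
  have := cardsC [set x | e x == ord0]; rewrite -/(content e ord0) c0 card_ord.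
  have -> : ~: [set x | e x == ord0] = supp e by apply/setP => x; rewrite !inE.
  by move=> E; apply/eqP; lia.
apply: eq_bigr => A /andP[gA /eqP cA]; rewrite (pcoef_colour _ gA) sum1dep_card.
pose h (e : {ffun 'I_n -> 'I_l.+1}) : {ffun 'I_n -> option 'I_l} := [ffun x => unlift ord0 (e x)].
pose h' (e : {ffun 'I_n -> option 'I_l}) : {ffun 'I_n -> 'I_l.+1} :=
  [ffun x => oapp (lift ord0) ord0 (e x)].
have hK : cancel h h'.
  by move=> e; apply/ffunP => x; rewrite !ffunE; case: unliftP => [j|] ->.
have h'K : cancel h' h.
  by move=> e; apply/ffunP => x; rewrite !ffunE; case: (e x) => [j|] /=; rewrite ?liftK ?unlift_none.
have inj_u : injective (unlift (ord0 : 'I_l.+1)).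
  by move=> u v; case: (unliftP ord0 u) => [u'|] ->; case: (unliftP ord0 v) => [v'|] -> // [->].
have contE e j : content e (lift ord0 j) = content (h e) (Some j).
  apply: eq_card => x; rewrite !inE ffunE.
  by case: (unliftP ord0 (e x)) => [i|] -> //; rewrite (inj_eq lift_inj).
have main e : (h e \in [set e : {ffun 'I_n -> option 'I_l} | [forall x, e (g x) == e x] &&
     [forall x, (e x == None) == (x \notin A)] && [forall j, Posz (content e (Some j)) == b j]]) =
   ((e \in [set e : {ffun 'I_n -> 'I_l.+1} | [forall x, e (g x) == e x] &&
     [forall j, Posz (content e j) == cons_ffun (n - k) b j]]) && (supp e == A)).
  rewrite !inE.
  have -> : [forall x, h e (g x) == h e x] = [forall x, e (g x) == e x].
    by apply: eq_forallb => x; rewrite !ffunE (inj_eq inj_u).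
  have -> : [forall x, (h e x == None) == (x \notin A)] = (supp e == A).
    have suppE x : (h e x == None) = (x \notin supp e).
      by rewrite ffunE inE negbK; case: (unliftP ord0 (e x)) => [j|] ->; rewrite ?eqxx // eq_sym (negPf (neq_lift _ _)).
    apply/forallP/eqP => [H|<- x]; last by rewrite suppE.
    by apply/setP => x; apply: negb_inj; rewrite -suppE (eqP (H x)).
  rewrite -andbA [RHS]andbAC -[RHS]andbA; congr (_ && _).
  case: (supp e =P A) => //= sE; apply/forallP/forallP => [H j|H j]; last first.
    by have := H (lift ord0 j); rewrite ffunE liftK contE.
  rewrite ffunE; case: (unliftP ord0 j) => [i|] ->; first by rewrite contE.
  rewrite eqz_nat; apply/eqP; have := cardsC [set x | e x == ord0].
  have -> : ~: [set x | e x == ord0] = A by rewrite -sE; apply/setP => x; rewrite !inE.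
  rewrite cA card_ord => E; apply: (@addIn k); rewrite subnK //; exact: E.
apply: (@eq_card_bij _ _ h h') => e; rewrite ?hK ?h'K //.
  by move=> eP; rewrite main; move: eP; rewrite inE.
by move=> eP; rewrite inE -main h'K.
Qed.

(* The character of S_n induced from chi^mu x 1 on S_k x S_p, n = k + p. *)
Definition hchar n p mu (g : 'S_n) : int :=
  alternate (fun b => Posz (pcoef (cyc_lens g) (cons_ffun p b))) (jt_shift (size mu) (nth 0%N mu)).

Lemma hcharE n (g : 'S_n) k mu : (k <= n)%N ->
  hchar (n - k) mu g = \sum_(A : {set 'I_n} | stable g A && (#|A| == k)) chi mu (lens_in g A).
Proof.
move=> kn; rewrite -alternate_sum; apply: eq_alternate => b.
rewrite pcoef_cons // -[LHS]natz natr_sum; apply: eq_bigr => A _; exact: natz.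
Qed.

Lemma hchar_type n p mu (g h : 'S_n) : cycle_type g = cycle_type h -> hchar p mu g = hchar p mu h.
Proof.
move=> E; apply: eq_alternate => b; congr Posz; apply: pcoef_perm.
apply: (@perm_trans _ (cycle_type g)); first by rewrite perm_sym perm_sort.
by rewrite E perm_sort.
Qed.

(** The condition that la/mu is a horizontal strip; beyond the two lengths all entries are 0, so a
    finite check decides it. *)
Definition strip la mu :=
  all (fun j => nth 0 la j.+1 <= nth 0 mu j <= nth 0 la j)%N (iota 0 (size la + size mu)).

Lemma stripP la mu : reflect (forall j, nth 0 la j.+1 <= nth 0 mu j <= nth 0 la j)%N (strip la mu).
Proof.
apply: (iffP allP) => [H j|H j _]; last exact: H.
have [lj|lj] := ltnP j (size la + size mu); first by apply: H; rewrite mem_iota.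
by rewrite !nth_default //; lia.
Qed.

(** The Pieri rule as a multiplicity: [sum_alternate] with the part n - k prepended, followed by
    [strip_pairE]. *)
Lemma hchar_mult n k la mu : (k <= n)%N -> la \in partitions n -> mu \in partitions k ->
  \sum_(g : 'S_n) hchar (n - k) mu g * irr_char la g = Posz (n`! * strip la mu)%N.
Proof.
move=> kn lap mup; have [la_dec la0 sla laB] := partitions_shape lap.
have [mu_dec mu0 smu muB] := partitions_shape mup.
under eq_bigr do rewrite mulrC irr_charE.
rewrite (@sum_alternate n (n + n) _ _ _ (@cons_ffun _ (n - k))) ?leq_addr //; last by rewrite jt_shift_sum sla.
rewrite PoszM; congr (_ * _).
apply: (@strip_pairE _ _ _ (n - k) (nth 0%N la) (nth 0%N mu)) => //.
- by rewrite ltnS (leq_trans muB) // leq_add.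
- by rewrite sla smu subnK.
exact: stripP.
Qed.

(* That n and n' may differ makes the coefficients in [alpha_expansion]
   independent of n. *)
Lemma fixed_chains_lens n n' T (g : 'S_n) (g' : 'S_n') (A : {set 'I_n}) (A' : {set 'I_n'}) :
    0%N \notin T -> stable g A -> stable g' A' -> perm_eq (lens_in g A) (lens_in g' A') ->
  fixed_chains T g A = fixed_chains T g' A'.
Proof.
move=> T0 gA gA' pE; have cE : #|A| = #|A'|.
  by rewrite -(sumn_lens_in gA) -(sumn_lens_in gA') (perm_sumn pE).
have [A0|[x xA]] := set_0Vmem A.
  have /eqP A'0 : A' == set0 by rewrite -cards_eq0 -cE A0 cards0.
  by rewrite A0 A'0 !fixed_chains0.
have /card_gt0P[y yA'] : (0 < #|A'|)%N by rewrite -cE; apply/card_gt0P; exists x.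
exact: (fixed_chains_eq _ x y).
Qed.

Lemma stableT n (g : 'S_n) : stable g setT.
Proof. by apply/stableP => x; rewrite !inE. Qed.

(** The multiplicity of chi^mu in F_k, the permutation character of S_k on the chains whose support
    is all of ['I_k]. *)
Definition chain_coef T k mu : rat :=
  (\sum_(h : 'S_k) (fixed_chains T h setT)%:R * (irr_char mu h)%:~R) / k`!%:R.

(** By [type_exists] some permutation of ['I_k] has the cycle lengths of [g] on [A]. It fixes
    equally many chains of full support, and the expansion of class functions on S_k applies to
    it. *)
Lemma fixed_chains_chi n T (g : 'S_n) (A : {set 'I_n}) : 0%N \notin T -> stable g A ->
  (fixed_chains T g A)%:R =
  \sum_(mu <- partitions #|A|) chain_coef T #|A| mu * (chi mu (lens_in g A))%:~R.
Proof.
move=> T0 gA; set k := #|A|.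
have nup : sort geq (lens_in g A) \in partitions k.
  rewrite mem_partitions sort_sorted ?all_sort; last by move=> x y; apply: leq_total.
  rewrite (perm_sumn (_ : perm_eq _ (lens_in g A))) ?perm_sort // sumn_lens_in // eqxx andbT /=.
  by apply/allP => _ /mapP[c /orbits_inP[x _ ->] ->]; rewrite lt0n card_porbit_neq0.
have [h hE] := type_exists nup.
have pE : perm_eq (lens_in g A) (lens_in h setT).
  by rewrite lens_inT -(perm_sort geq) -hE perm_sort.
rewrite (fixed_chains_lens T0 gA (stableT h) pE).
rewrite (@class_fun_expansion k (fun h => (fixed_chains T h setT)%:R)) => [|h1 h2 E]; last first.
  congr (_%:R); apply: fixed_chains_lens (stableT _) (stableT _) _ => //.
  by rewrite !lens_inT -(perm_sort geq) -[sort _ _]/(cycle_type h1) E perm_sort.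
apply: eq_bigr => mu _; congr (_ * _%:~R); rewrite irr_charE.
by apply: chi_perm; rewrite -lens_inT perm_sym.
Qed.

Lemma chain_support_stable n T (g : 'S_n) (C : {set {set {set 'I_n}}}) : rank_chain T C ->
  chain_act g C = C -> stable g (chain_support C).
Proof.
move=> /and4P[/subsetP Cp _ _ _] gC; apply/stableP => x; apply/bigcupP/bigcupP => -[P PC xP].
  move: PC; rewrite -{1}gC => /imsetP[Q QC PE]; exists Q => //.
  by move: xP; rewrite PE support_pact ?Cp // (mem_imset _ _ (@perm_inj _ g)).
exists (pact g P); first by rewrite -gC imset_f.
by rewrite support_pact ?Cp // imset_f.
Qed.

(** Supports are nested along a chain, so the largest one contains all the others. *)
Lemma card_chain_support n T i (C : {set {set {set 'I_n}}}) : rank_chain T C ->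
  all (fun t => t <= i)%N T -> (#|chain_support C| <= 2 * i)%N.
Proof.
move=> /and4P[/subsetP Cp /is_chainP Cch /forallP Crk _] /allP Ti.
have [->|[P0 P0C]] := set_0Vmem C; first by rewrite /chain_support big_set0 cards0.
have [M MC Mmax] := @arg_maxnP _ P0 (fun P => P \in C) (fun P => #|psupport P|) P0C.
have sub : chain_support C \subset psupport M.
  apply/bigcupsP => P PC; case/orP: (Cch P M PC MC) => H.
    by apply: support_refines H; apply: Cp.
  have sMP := support_refines (Cp _ MC) (Cp _ PC) H.
  suff -> : psupport M = psupport P by [].
  by apply/eqP; rewrite eqEcard sMP; apply: Mmax.
apply: leq_trans (subset_leq_card sub) _; apply: leq_trans (card_support (Cp _ MC)) _.
by rewrite leq_mul2l /= Ti //; apply: (implyP (Crk M)).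
Qed.

(** Fixed chains are sorted by their support, a [g]-stable set of at most 2i points; summing
    [chi mu] of the cycles inside A over all stable A of size k produces [hchar]. *)
Lemma alpha_expansion n i (Tn : {set 'I_n}) T (g : 'S_n) :
    (forall t, (t \in T) = [exists s in Tn, val s == t]) ->
    0%N \notin T -> all (fun t => t <= i)%N T -> (2 * i <= n)%N ->
  (alpha Tn g)%:R = \sum_(k < (2 * i).+1) \sum_(mu <- partitions k)
    chain_coef T k mu * (hchar (n - k) mu g)%:~R.
Proof.
move=> TE T0 Ti in_; pose Q (C : {set {set {set 'I_n}}}) := rank_chain T C && (chain_act g C == C).
have -> : alpha Tn g = (\sum_(A : {set 'I_n} | stable g A && (#|A| < (2 * i).+1)) fixed_chains T g A)%N.
  rewrite /alpha (eq_card (B := [set C | Q C])) => [|C]; last by rewrite !inE (max_chainE _ TE).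
  rewrite -sum1_card (partition_big (@chain_support n) (fun A => stable g A && (#|A| < (2 * i).+1)%N)).
    apply: eq_bigr => A _; rewrite /fixed_chains -sum1_card; apply: eq_bigl => C.
    by rewrite !inE -andbA.
  move=> C; rewrite inE => /andP[rC /eqP gC].
  by rewrite (chain_support_stable rC gC) ltnS (card_chain_support rC).
(* Only sets of at most 2i points occur, so [inord] keeps their size. *)
rewrite natr_sum (partition_big (fun A : {set 'I_n} => inord #|A| : 'I_(2 * i).+1) xpredT) //=.
apply: eq_bigr => k _.
have kn : (k <= n)%N by apply: leq_trans in_; rewrite -ltnS.
under [RHS]eq_bigr do rewrite hcharE // rmorph_sum mulr_sumr /=.
rewrite [RHS]exchange_big /=; apply: eq_big => [A|A /andP[/andP[gA Ai] /eqP Ak]].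
  case: (stable g A) => //=; apply/andP/idP => [[lt /eqP <-]|/eqP E].
    by rewrite inordK.
  have lt : (#|A| < (2 * i).+1)%N by rewrite E.
  by split=> //; apply/eqP/val_inj; rewrite /= inordK.
have <- : #|A| = k by rewrite -Ak inordK.
exact: fixed_chains_chi.
Qed.

Definition set_ranks n (T : {set 'I_n}) : seq nat := [seq val t | t <- enum T].

(** As all ranks in [S] are at most i, subsets of ['I_i.+1] can replace those of ['I_n]; this makes
    the coefficient independent of n. *)
Definition beta_coef (S : seq nat) i k mu : rat :=
  \sum_(T : {set 'I_i.+1} | T \subset Sset i.+1 S)
    (-1) ^+ #|Sset i.+1 S :\: T| * chain_coef (set_ranks T) k mu.

Lemma beta_expansion S i n (g : 'S_n) :
    0%N \notin S -> all (fun t => t <= i)%N S -> (2 * i <= n)%N -> (i < n)%N ->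
  (beta S g)%:~R = \sum_(k < (2 * i).+1) \sum_(mu <- partitions k)
    beta_coef S i k mu * (hchar (n - k) mu g)%:~R.
Proof.
move=> S0 /allP Si in2 ltin; pose w (t : 'I_i.+1) : 'I_n := widen_ord ltin t.
have w_inj : injective w by move=> x y /(congr1 val) /= /val_inj.
have SsetE : Sset n S = [set w t | t in Sset i.+1 S].
  apply/setP => t; apply/idP/imsetP => [|[s sS ->]]; last by move: sS; rewrite !inE.
  rewrite inE => tS; have lt : (val t < i.+1)%N by rewrite ltnS Si.
  by exists (Ordinal lt); [rewrite inE | apply: val_inj].
have -> : beta S g = \sum_(T : {set 'I_i.+1} | T \subset Sset i.+1 S)
    (-1) ^+ #|Sset i.+1 S :\: T| * Posz (alpha [set w t | t in T] g).
  rewrite /beta (reindex_onto (fun T : {set 'I_i.+1} => [set w t | t in T])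
    (fun T => w @^-1: T)) => [|T /subsetP TS] /=; last first.
    apply/setP => t; apply/imsetP/idP => [[s]|tT]; first by rewrite inE => sT ->.
    by have := TS t tT; rewrite SsetE => /imsetP[s _ tE]; exists s; rewrite ?inE -?tE.
  apply: eq_big => [T|T _]; last first.
    congr ((-1) ^+ _ * _); rewrite SsetE -[RHS](card_imset _ w_inj); apply: eq_card => t.
    rewrite inE; apply/andP/imsetP => [[tT /imsetP[s sS tE]]|[s sST ->]].
      by exists s; rewrite // in_setD sS andbT; apply: contra tT => sT; rewrite tE imset_f.
    by move: sST; rewrite !(mem_imset _ _ w_inj) in_setD => /andP[].
  have -> : w @^-1: [set w t | t in T] = T.
    by apply/setP => t; rewrite inE (mem_imset _ _ w_inj).
  rewrite eqxx andbT SsetE; apply/subsetP/subsetP => H t.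
    by move=> tT; rewrite -(mem_imset _ _ w_inj) H // imset_f.
  by move=> /imsetP[s sT ->]; rewrite imset_f // H.
rewrite rmorph_sum /=; transitivity (\sum_(T : {set 'I_i.+1} | T \subset Sset i.+1 S)
   \sum_(k < (2 * i).+1) \sum_(mu <- partitions k)
   ((-1) ^+ #|Sset i.+1 S :\: T| * chain_coef (set_ranks T) k mu * (hchar (n - k) mu g)%:~R)).
  apply: eq_bigr => T /subsetP TS.
  have mem_ranks t : (t \in set_ranks T) = [exists s in [set w t | t in T], val s == t].
    apply/mapP/existsP => [[s]|[s /andP[/imsetP[u uT ->] /eqP <-]]].
      by rewrite mem_enum => sT ->; exists (w s); rewrite imset_f //= eqxx.
    by exists u; rewrite ?mem_enum.
  rewrite rmorphM rmorphXn rmorphN1 /= -pmulrn (@alpha_expansion _ i _ (set_ranks T)) //.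
  - rewrite mulr_sumr; apply: eq_bigr => k _; rewrite mulr_sumr; apply: eq_bigr => mu _.
    by rewrite mulrA.
  - apply/mapP => -[s]; rewrite mem_enum => /TS; rewrite inE => sS s0.
    by rewrite -[val s]s0 (negPf S0) in sS.
  - by apply/allP => _ /mapP[s _ ->]; rewrite -ltnS; apply: ltn_ord.
rewrite exchange_big; apply: eq_bigr => k _; rewrite exchange_big; apply: eq_bigr => mu _.
by rewrite -mulr_suml.
Qed.

Lemma beta_mult S i n la :
    0%N \notin S -> all (fun t => t <= i)%N S -> (2 * i <= n)%N -> (i < n)%N ->
    la \in partitions n ->
  mult (@beta S n) la = \sum_(k < (2 * i).+1) \sum_(mu <- partitions k)
    beta_coef S i k mu * (strip la mu)%:R.
Proof.
move=> S0 Si in2 ltin lap; rewrite /mult rmorph_sum /=.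
under eq_bigr do rewrite rmorphM /= (beta_expansion _ S0 Si in2 ltin) mulr_suml.
rewrite exchange_big mulr_suml; apply: eq_bigr => k _ /=.
under eq_bigr do rewrite mulr_suml.
rewrite exchange_big mulr_suml [LHS]big_seq [RHS]big_seq; apply: eq_bigr => mu mup /=.
have kn : (k <= n)%N by apply: leq_trans in2; rewrite -ltnS.
under eq_bigr do rewrite -mulrA -rmorphM /=.
rewrite -mulr_sumr -rmorph_sum /= hchar_mult // -mulrA; congr (_ * _).
by rewrite -pmulrn natrM mulrAC divff ?factr_neq0 // mul1r.
Qed.

End Expansion.

(** * Stability *)

Section Stability.

Lemma partition_cons n la : 0 < n -> la \in partitions n -> exists x r, la = x :: r.
Proof.
rewrite mem_partitions; case: la => [|x r] n0; last by move=> _; exists x, r.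
by move=> /and3P[_ _ /eqP E]; rewrite -E in n0.
Qed.

Lemma nth_add_first la m j : la != [::] ->
  nth 0 (add_first la m) j = nth 0 la j + (j == 0) * m.
Proof. by case: la => //= x r _; case: j => [|j] /=; rewrite ?mul1n ?mul0n ?addn0. Qed.

Lemma add_first_partition n m la : 0 < n -> la \in partitions n ->
  add_first la m \in partitions (n + m).
Proof.
move=> n0 lap; have [x [r laE]] := partition_cons n0 lap; move: lap.
rewrite !mem_partitions laE /= => /and3P[srt /andP[x0 pos] /eqP <-].
rewrite pos addn_gt0 x0 /= addnAC eqxx andbT.
by case: r srt {laE pos} => //= y r /andP[yx ->]; rewrite andbT; lia.
Qed.

Lemma add_first_inj n m : 0 < n ->
  {in partitions n &, injective (fun la => add_first la m)}.
Proof.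
move=> n0 la mu lap mup; have [x [r ->]] := partition_cons n0 lap.
by have [y [s ->]] := partition_cons n0 mup; move=> /= [/addIn -> ->].
Qed.

(** The rows of [la] below the first are bounded by the successive rows of [mu]. *)
Lemma strip_sumn la mu : strip la mu -> sumn la <= nth 0 la 0 + sumn mu.
Proof.
move=> /stripP H; pose M := size la + size mu.
rewrite -(@sum_nth_le M.+1 la) ?big_ord_recl; last by rewrite leqW // leq_addr.
rewrite leq_add2l -(@sum_nth_le M mu) ?leq_addl //; apply: leq_sum => j _.
by case/andP: (H j).
Qed.

(** Only the bound mu_0 <= la_0 could be affected by [m], and the other strip conditions already
    force it: by [strip_sumn], la_0 >= n - k >= k >= mu_0. *)
Lemma strip_add_first n k m la mu : 0 < n -> 2 * k <= n -> la \in partitions n ->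
  mu \in partitions k -> strip (add_first la m) mu = strip la mu.
Proof.
move=> n0 kn lap; rewrite mem_partitions => /and3P[_ _ /eqP sk].
have [x [r laE]] := partition_cons n0 lap.
have la_n : sumn la = n by move: lap; rewrite mem_partitions => /and3P[_ _ /eqP].
have nE j : nth 0 (add_first la m) j.+1 = nth 0 la j.+1.
  by rewrite nth_add_first ?laE // addn0.
apply/stripP/stripP => H j; have := H j; rewrite nE => /andP[-> /=]; last first.
  by move=> le; rewrite nth_add_first ?laE // -laE; apply: leq_trans le (leq_addr _ _).
case: j => [|j]; last by rewrite nE.
have /strip_sumn : strip (add_first la m) mu by apply/stripP.
have := nth_le_sumn mu 0; rewrite laE /= in la_n *; lia.
Qed.

(** By [strip_sumn], nu_0 >= n + m - k, while nu_1 <= mu_0 <= k <= n - k; hence m boxes can be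
    removed from the first row. *)
Lemma strip_unstable n k m nu mu : 2 * k <= n -> 0 < n -> nu \in partitions (n + m) ->
  mu \in partitions k -> strip nu mu ->
  exists2 la, la \in partitions n & nu = add_first la m.
Proof.
move=> kn n0 nup; rewrite mem_partitions => /and3P[_ _ /eqP sk] snm.
have [|x [r nuE]] := @partition_cons (n + m) nu _ nup; first by rewrite addn_gt0 n0.
have le1 := strip_sumn snm; have /stripP/(_ 0)/andP[le2 _] := snm.
have le3 := nth_le_sumn mu 0.
move: nup; rewrite mem_partitions nuE /= => /and3P[srt /andP[x0 pos] /eqP nusum].
rewrite nuE /= in le1 le2.
exists (x - m :: r); last by rewrite /= subnK //; lia.
rewrite mem_partitions /= pos andbT.
have -> : 0 < x - m by lia.
have -> : x - m + sumn r == n by lia.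
rewrite andbT; case: r srt le1 le2 nusum {nuE pos} => //= y r /andP[_ ->] le1 le2 nusum.
by rewrite andbT; lia.
Qed.

End Stability.

(** * Stabilization of [beta] and its sharpness *)

Section BetaStability.
Local Open Scope ring_scope.

Lemma multE n (phi : 'S_n -> int) la :
  mult phi la = (\sum_h (phi h)%:~R * (irr_char la h)%:~R) / n`!%:R.
Proof.
by rewrite /mult rmorph_sum; congr (_ / _); apply: eq_bigr => h _; rewrite rmorphM.
Qed.

Lemma beta_type S i n (g h : 'S_n) :
    0%N \notin S -> all (fun t => t <= i)%N S -> (2 * i <= n)%N -> (i < n)%N ->
  cycle_type g = cycle_type h -> beta S g = beta S h.
Proof.
move=> S0 Si in2 ltin E; apply/(@intr_inj rat).
rewrite !(beta_expansion _ S0 Si in2 ltin); apply: eq_bigr => k _; apply: eq_bigr => mu _.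
by rewrite (hchar_type _ _ E).
Qed.

Lemma beta_stab S i : 0%N \notin S -> all (fun t => t <= i)%N S -> (0 < i)%N ->
  stab_beyond (beta S) (4 * i).
Proof.
move=> S0 Si i0 m g; set n0 := (4 * i)%N; rewrite /stab_plus.
have n00 : (0 < n0)%N by rewrite /n0; lia.
have in2 : (2 * i <= n0)%N by rewrite leq_mul2r orbT.
have ltin : (i < n0)%N by rewrite /n0; lia.
have in2' : (2 * i <= n0 + m)%N by apply: leq_trans in2 (leq_addr _ _).
have ltin' : (i < n0 + m)%N by apply: leq_trans ltin (leq_addr _ _).
rewrite (@class_fun_expansion _ (fun g => (beta S g)%:~R)) => [|g1 g2 E]; last first.
  by rewrite (beta_type S0 Si in2' ltin' E).
(* The multiplicity as a function of the shape alone, the same function for n0 and for n0 + m. *)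
pose c nu := \sum_(k < (2 * i).+1) \sum_(mu <- partitions k)
    beta_coef S i k mu * (strip nu mu)%:R.
rewrite big_seq (eq_bigr (fun nu => c nu * (irr_char nu g)%:~R)) => [|nu nup]; last first.
  by rewrite -multE (beta_mult S0 Si).
rewrite -big_seq [RHS]big_seq.
rewrite [RHS](eq_bigr (fun la => c (add_first la m) * (irr_char (add_first la m) g)%:~R)); last first.
  move=> la lap; rewrite (beta_mult S0 Si) //; congr (_ * _).
  apply: eq_bigr => k _; rewrite [LHS]big_seq [RHS]big_seq; apply: eq_bigr => mu mup.
  rewrite (@strip_add_first n0 k) //.
  by have := ltn_ord k; rewrite /n0; lia.
rewrite -big_seq -[RHS](big_map (fun la => add_first la m) xpredT
  (fun nu => c nu * (irr_char nu g)%:~R)).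
(* Shapes outside the image of la |-> la + (m) have multiplicity 0 by [strip_unstable]. *)
set im := map _ _; rewrite (bigID (mem im)) /= [X in _ + X]big_seq_cond [X in _ + X]big1 ?addr0.
  rewrite -big_filter; apply: perm_big; apply: uniq_perm.
  - by rewrite filter_uniq // partitions_uniq.
  - by rewrite (map_inj_in_uniq (add_first_inj _)) // partitions_uniq.
  move=> nu; rewrite mem_filter /=; apply/andP/idP => [[]//|nuim]; split=> //.
  by have /mapP[la lap ->] := nuim; apply: add_first_partition.
move=> nu /andP[nup nuim]; rewrite /c big1 ?mul0r // => k _; rewrite big_seq big1 // => mu mup.
case E: (strip nu mu); last by rewrite mulr0.
case/negP: nuim; have [||la lap ->] := strip_unstable _ _ nup mup E => //.
  by have := ltn_ord k; rewrite /n0; lia.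
exact: (map_f (fun la => add_first la m)).
Qed.

Lemma irr_char1 n (g : 'S_n) : irr_char [:: n] g = 1.
Proof.
rewrite irr_charE /chi /alternate (big_pred1 1%g) => [|s] /=; last first.
  by apply/esym/eqP/permP => x; rewrite !ord1.
rewrite odd_perm1 mul1r; congr Posz; rewrite /pcoef.
rewrite (eq_card1 (x := [ffun=> ord0])) // => f; rewrite !inE.
have fE : f = [ffun=> ord0] by apply/ffunP => x; rewrite ffunE ord1.
rewrite fE eqxx; apply/forallP => j; rewrite !ffunE perm1 !ord1 /= subr0 addr0.
rewrite (eq_bigl xpredT) => [|x]; last by rewrite ffunE eqxx.
by rewrite sum_nth_sumn sumn_cyc_lens.
Qed.

(** The pairing of x with x + i: each of the 2i points lies in a block of size 2 and has defect
    1/2. *)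
Lemma pairing_setpart i : (0 < i)%N -> exists P : {set {set 'I_(2 * i)}},
  [/\ P \in setpart (2 * i), prank P = i & psupport P = setT].
Proof.
move=> i0; have lt_p (x : 'I_(2 * i)) : ((if x < i then x + i else x - i) < 2 * i)%N.
  by case: (ltnP x i); have := ltn_ord x; lia.
pose p x := Ordinal (lt_p x).
have pK : involutive p.
  move=> x; apply: val_inj => /=; case: (ltnP x i) => xi.
    by rewrite ltnNge leq_addl addnK.
  by rewrite ifT ?subnK //; have := ltn_ord x; lia.
have p_neq x : p x != x.
  by rewrite -val_eqE /=; case: (ltnP x i); lia.
have [] := @setpart_of_blocks _ (fun x => [set x; p x]).
- by move=> x; rewrite !inE eqxx.
- by move=> x y; rewrite !inE => /orP[] /eqP -> //; rewrite pK setUC.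
set P := [set _ | _ in _] => Pp PE; exists P; split=> //.
  apply/eqP; rewrite -(eqr_nat rat) prank_sum //.
  rewrite (eq_bigr (fun=> 2%:R^-1)) => [|x _].
    by rewrite sumr_const card_ord -[_ *+ (2 * i)]mulr_natl natrM mulrAC divff ?mul1r.
  rewrite /block_defect PE cards2 eq_sym p_neq /=.
  lra.
apply/setP => x; rewrite !inE PE; apply: contraNneq (p_neq x) => /setP/(_ (p x)).
by rewrite !inE eqxx orbT => /esym/eqP ->.
Qed.

(** The empty T contributes nothing, its only chain having empty support. For T = {i} all terms of
    the average are non-negative, and the identity fixes the chain formed by a single perfect
    pairing. *)
Lemma beta_coef_top_gt0 S i : S =i [:: i] -> (0 < i)%N ->
  0 < beta_coef S i (2 * i) [:: (2 * i)%N].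
Proof.
move=> SE i0; have SsetE : Sset i.+1 S = [set ord_max].
  by apply/setP => t; rewrite !inE SE inE -val_eqE.
rewrite /beta_coef SsetE (bigD1 [set ord_max]) //= setDv cards0 expr0 mul1r.
rewrite big1 => [|T /andP[]]; last first.
  rewrite subset1 => /orP[/eqP -> /eqP //|/eqP -> _]; rewrite /chain_coef big1 ?mul0r ?mulr0 // => h _.
  rewrite (_ : fixed_chains _ _ _ = 0%N) ?mul0r //; apply/eqP; rewrite cards_eq0.
  apply/eqP/setP => C; rewrite !inE; apply/negP => /and3P[/and4P[_ _ /forallP Crk _] _ /eqP sC].
  have i2 : (0 < 2 * i)%N by rewrite muln_gt0.
  have : Ordinal i2 \in chain_support C by rewrite sC inE.
  move=> /bigcupP[P PC _]; have := implyP (Crk P) PC.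
  by rewrite /set_ranks enum_set0.
rewrite addr0 /chain_coef divr_gt0 ?ltr0n ?fact_gt0 //.
under eq_bigr do rewrite irr_char1 mulr1.
rewrite -natr_sum ltr0n (bigD1 1%g) //= addn_gt0; apply/orP; left.
have [P [Pp Pr Ps]] := pairing_setpart i0.
apply/card_gt0P; exists [set P]; rewrite inE; apply/and3P; split.
- apply/and4P; split.
  + by rewrite sub1set.
  + by apply/is_chainP => Q R; rewrite !inE => /eqP -> /eqP ->; rewrite refines_refl.
  + apply/forallP => Q; apply/implyP; rewrite inE => /eqP ->.
    by rewrite Pr /set_ranks enum_set1 inE.
  by rewrite /set_ranks enum_set1 /= andbT; apply/existsP; exists P; rewrite inE Pr !eqxx.
- rewrite /chain_act imset_set1; apply/eqP; congr [set _].
  have [gPp gE] := pact_setpart 1%g Pp; apply: eq_setpart => // x.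
  rewrite -{1}[x](perm1 x) gE -[RHS]imset_id; apply: eq_imset => y; exact: perm1.
by rewrite /chain_support big_set1 Ps.
Qed.

Lemma beta_unstab S i n1 : S =i [:: i] -> (0 < i)%N -> (0 < n1)%N -> (n1 < 4 * i)%N ->
  ~ stab_beyond (beta S) n1.
Proof.
move=> SE i0 n10 lt_n1 stab; pose m := (4 * i - n1)%N.
have NE : (n1 + m = 4 * i)%N by rewrite subnKC // ltnW.
have m0 : (0 < m)%N by rewrite subn_gt0.
have S0 : 0%N \notin S by rewrite SE inE eq_sym -lt0n.
have Si : all (fun t => t <= i)%N S by apply/allP => t; rewrite SE inE => /eqP ->.
pose nu := [:: (2 * i)%N; (2 * i)%N].
have nup : nu \in partitions (n1 + m).
  by rewrite mem_partitions NE /= leqnn !muln_gt0 i0 /=; lia.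
(* In every shape occurring in [stab_plus] the first part exceeds the second by at least m > 0, so
   orthogonality excludes (2i,2i). *)
have : mult (@beta S (n1 + m)) nu = 0.
  rewrite multE; under eq_bigr do rewrite stab /stab_plus mulr_suml.
  rewrite exchange_big big1_seq ?mul0r //= => la lap.
  under eq_bigr do rewrite -mulrA -rmorphM /=.
  rewrite -mulr_sumr -rmorph_sum /= irr_char_ortho ?add_first_partition //.
  suff /negPf -> : add_first la m != nu by rewrite muln0 mulr0.
  apply/eqP; have [x [r laE]] := partition_cons n10 lap.
  rewrite laE /= => -[xm rE]; move: lap; rewrite laE rE mem_partitions /= => /and3P[].
  by rewrite andbT; lia.
rewrite (beta_mult S0 Si) ?NE; [|lia|lia|by rewrite -NE].
(* The strip condition gives 2i <= mu_0 <= k, which leaves k = 2i and then mu = (2i). *)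
rewrite (bigD1 ord_max) //= [X in _ + X]big1 ?addr0 => [|k neq]; last first.
  rewrite big_seq big1 // => mu; rewrite mem_partitions => /and3P[_ _ /eqP sk].
  case E: (strip nu mu); last by rewrite mulr0.
  have /stripP/(_ 0%N)/andP[/= le _] := E; have := nth_le_sumn mu 0; rewrite sk.
  by move: neq; rewrite -val_eqE /=; have := ltn_ord k; lia.
have top : [:: (2 * i)%N] \in partitions (2 * i).
  by rewrite mem_partitions /= addn0 eqxx muln_gt0 i0.
rewrite (bigD1_seq [:: (2 * i)%N]) ?partitions_uniq //= big_seq_cond big1 ?addr0.
  have -> : strip nu [:: (2 * i)%N] by apply/stripP => -[|[|j]] /=; rewrite ?leqnn ?nth_nil //; case: j.
  by rewrite mulr1 => E; have := beta_coef_top_gt0 SE i0; rewrite E ltxx.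
move=> mu /andP[mup neq]; case E: (strip nu mu); last by rewrite mulr0.
case/eqP: neq; have /stripP/(_ 0%N)/andP[/= le1 le2] := E.
move: mup; rewrite mem_partitions => /and3P[_ pos /eqP sk].
case: mu le1 le2 pos sk {E} => [|x [|y r]] /=; [lia | move=> *; congr [:: _]; lia | lia].
Qed.

End BetaStability.

Theorem theorem1p7 (S : seq nat) (i : nat) :
  S != [::] -> all (fun x => 0 < x)%N S -> \max_(x <- S) x = i ->
  stab_beyond (beta S) (4 * i) /\
  (S =i [:: i] ->
     forall n1, (i + 2 <= n1)%N -> (n1 < 4 * i)%N -> ~ stab_beyond (beta S) n1).
Proof.
move=> Sn /allP Spos Smax.
have Si : all (fun t => t <= i)%N S.
  by apply/allP => t tS; rewrite -Smax (leq_bigmax_seq (F := id)).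
have S0 : 0 \notin S by apply/negP => /Spos.
have i0 : 0 < i.
  case: S Sn Spos Si {Smax S0} => // x S _ Spos /andP[xi _].
  by apply: leq_trans xi; apply: Spos; rewrite inE eqxx.
split; first exact: beta_stab Si _.
by move=> SE n1 le_n1 lt_n1; apply: beta_unstab SE _ _ lt_n1 => //; lia.
Qed.
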